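(* Modulo $11$ (coefficientwise): \begin{align*} T^{C}_{2,0}\equiv T^{C}_{4,0}\equiv T^{C}_{6,0}\equiv T^{C}_{8,0}&\equiv 0,\\ T^{C}_{2,1}\equiv T^{C}_{4,1}\equiv T^{C}_{6,1}\equiv T^{C}_{8,1}&\equiv 2\tfrac{J_{11}^2P_5}{P_2P_3},\\ 7T^{C}_{2,2}\equiv 10T^{C}_{4,2}\equiv 8T^{C}_{6,2}\equiv 2T^{C}_{8,2}&\equiv \tfrac{J_{11}^2P_3}{P_1P_4},\\ 8T^{C}_{2,3}\equiv 7T^{C}_{4,3}\equiv 2T^{C}_{6,3}\equiv 10T^{C}_{8,3}&\equiv \tfrac{J_{11}^2P_2}{P_1P_3},\\ 8T^{C}_{2,4}\equiv 9T^{C}_{4,4}\equiv 3T^{C}_{6,4}\equiv 6T^{C}_{8,4}&\equiv \tfrac{J_{11}^2}{P_2},\\ 3T^{C}_{2,5}\equiv 2T^{C}_{4,5}\equiv 8T^{C}_{6,5}\equiv 5T^{C}_{8,5}&\equiv \tfrac{J_{11}^2P_4}{P_2P_5},\\ T^{C}_{2,7}\equiv 7T^{C}_{4,7}\equiv 10T^{C}_{6,7}\equiv 5T^{C}_{8,7}&\equiv \tfrac{J_{11}^2}{P_3},\\ 7T^{C}_{2,8}\equiv 9T^{C}_{4,8}\equiv 9T^{C}_{6,8}\equiv 7T^{C}_{8,8}&\equiv \tfrac{qJ_{11}^2P_1}{P_4P_5},\\ T^{C}_{2,9}\equiv 9T^{C}_{4,9}\equiv 4T^{C}_{6,9}\equiv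 3T^{C}_{8,9}&\equiv \tfrac{J_{11}^2}{P_4},\\ 3T^{C}_{2,10}\equiv 4T^{C}_{4,10}\equiv 9T^{C}_{6,10}\equiv T^{C}_{8,10}&\equiv \tfrac{J_{11}^2}{P_5}. \end{align*}
   Context: The crank of a partition $\pi$: let $\lambda(\pi)$ be its largest part, $\omega(\pi)$ its number of parts equal to $1$, $\mu(\pi)$ its number of parts larger than $\omega(\pi)$; the crank is $\lambda(\pi)$ if $\omega(\pi)=0$ and $\mu(\pi)-\omega(\pi)$ otherwise. For $n\ge2$, $M(m,n)$ is the number of partitions of $n$ with crank $m$; for $n\le1$ set $M(0,0)=1$, $M(0,1)=-1$, $M(1,1)=M(-1,1)=1$, $M(m,n)=0$ otherwise. For even $k\ge2$, $M_k(n):=\sum_{m\in\mathbb Z}m^kM(m,n)$ and $T^C_{k,r}(q):=\sum_{n\ge0}M_k(11n+r)q^n$. $(x;q)_\infty=\prod_{i\ge0}(1-xq^i)$; $J_{a,m}:=(q^a;q^m)_\infty(q^{m-a};q^m)_\infty(q^m;q^m)_\infty$, $J_m:=(q^m;q^m)_\infty$, $P_i:=J_{i,11}$. *)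

(* Defs.v *)
From HB Require Import structures.
From mathcomp Require Import all_boot all_order all_algebra.
Set Implicit Arguments. Unset Strict Implicit. Unset Printing Implicit Defensive.
Import Order.TTheory GRing.Theory Num.Theory.
Local Open Scope ring_scope.

(* A partition of n is encoded by its multiplicity function:
   f i = number of parts equal to i.+1  (parts lie in 1..n, multiplicities in 0..n). *)
Definition ptn (n : nat) := {ffun 'I_n -> 'I_n.+1}.

Definition is_partition (n : nat) (f : ptn n) : bool :=
  (\sum_(i < n) i.+1 * f i)%N == n.

Definition omega (n : nat) (f : ptn n) : nat := (\sum_(i < n | val i == 0%N) f i)%N.
Definition lambda (n : nat) (f : ptn n) : nat := (\max_(i < n | f i != 0 :> nat) i.+1)%N.
Definition mu (n : nat) (f : ptn n) : nat := (\sum_(i < n | omega f < i.+1) f i)%N.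

Definition crank (n : nat) (f : ptn n) : int :=
  if omega f == 0%N then (lambda f)%:Z else (mu f)%:Z - (omega f)%:Z.

Definition Mcrank (m : int) (n : nat) : int :=
  match n with
  | 0%N => (m == 0)%:Z
  | 1%N => if m == 0 then -1 else if (m == 1) || (m == -1) then 1 else 0
  | n'.+2 => (#|[set f : ptn n'.+2 | is_partition f & crank f == m]|)%:Z
  end.

(* M_k(n) = sum_{m in Z} m^k M(m,n); M(m,n) = 0 for |m| > n+1, so the
   sum is taken over m = -(n+1) .. n+1. *)
Definition Mmoment (k n : nat) : int :=
  \sum_(i < (2 * n + 3)%N) (i%:Z - (n.+1)%:Z) ^+ k * Mcrank (i%:Z - (n.+1)%:Z) n.

Definition fps := nat -> int.

Definition fone : fps := fun n => (n == 0%N)%:Z.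
Definition fmul (f g : fps) : fps := fun n => \sum_(i < n.+1) f i * g (n - i)%N.
Definition fscale (c : int) (f : fps) : fps := fun n => c * f n.
Definition fqpow (e : nat) : fps := fun n => (n == e)%:Z.
Definition one_minus_q (e : nat) : fps := fun n => (n == 0%N)%:Z - (n == e)%:Z.
(* 1/(1 - q^e) = sum_j q^(e j)   (used with e >= 1) *)
Definition geom (e : nat) : fps := fun n => (e %| n)%N%:Z.

(* Infinite product prod_{k >= 0} F k, for factors with F k = 1 + O(q^(k+1)):
   the coefficient of q^n only depends on the first n+1 factors. *)
Definition infprod (F : nat -> fps) : fps :=
  fun n => (\big[fmul/fone]_(k < n.+1) F k) n.

(* (q^a; q^m)_oo  and its reciprocal  (a, m >= 1) *)
Definition qpoch (a m : nat) : fps := infprod (fun k => one_minus_q (a + m * k)).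
Definition qpoch_inv (a m : nat) : fps := infprod (fun k => geom (a + m * k)).

Definition J (m : nat) : fps := qpoch m m.
Definition Jam (a m : nat) : fps := fmul (qpoch a m) (fmul (qpoch (m - a) m) (qpoch m m)).
Definition Jam_inv (a m : nat) : fps :=
  fmul (qpoch_inv a m) (fmul (qpoch_inv (m - a) m) (qpoch_inv m m)).

Definition P (i : nat) : fps := Jam i 11.
Definition Pinv (i : nat) : fps := Jam_inv i 11.

Definition TC (k r : nat) : fps := fun n => Mmoment k (11 * n + r).

Definition cong11 (f g : fps) : Prop := forall n, (f n = g n %[mod 11])%Z.

(* Main.v *)
(* Let z be a primitive 11th root of unity.  By the Andrews-Garvan formula, the
   generating function of sum_m M(m,n) z^m is C = (q)/((zq)(q/z)); since the
   product of all (z^k q) is (q^11;q^11), C times (q^11;q^11) is, up to a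
   constant, the left-hand side of Winquist's identity at a = z^5, b = z^2.
   Winquist's identity turns it into a 2 x 2 determinant of theta series, whose
   11-dissection is a combination of products of two theta series in q^11.  The
   part with exponents congruent to r mod 11 is a constant c_r in Z[z] times one
   instance of the same determinant with base q^11 and with powers of q for a and b
   (and then q^11 for q), which Winquist's identity evaluates as a quotient of P_i.  Hence
   sum_m M(m,11n+r) z^m = c_r * F_r(n) with F_r(n) an integer.  An integer
   polynomial vanishing at z is a multiple of 1 + X + ... + X^10, and the sum of
   j^k over the residues mod 11 vanishes for k = 2, 4, 6, 8; so substituting j^k
   for z^j in that equation is legitimate modulo 11 and yields the moments. *)
Require Import Defs.
From HB Require Import structures.
From mathcomp Require Import all_boot all_order all_algebra all_field.
From mathcomp Require Import boolp classical_sets fsbigop.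
From mathcomp Require Import zify ring.
Set Implicit Arguments. Unset Strict Implicit. Unset Printing Implicit Defensive.
Import Order.TTheory GRing.Theory Num.Theory.
Local Open Scope ring_scope.

(** * Power series *)

(** The exponents 5 and 2 are chosen so that a, b, ab, a/b and their inverses are z^5, z^2, z^7,
    z^3, z^6, z^9, z^4, z^8: every nontrivial power of z except z and z^10, the two in the
    denominator of the crank. An infinite product has no evident dissection, but the determinant is
    bilinear in one-variable theta series, and those dissect by residues of the summation index;
    hence Winquist's identity is used once at z to leave the product form and once at powers of q to
    return to it. Its proof rests on two changes of variables on Z^2: one turns the product of the
    theta series at ab and a/b into a determinant, the other expresses each entry through two series
    U and V by a matrix free of the argument, so that only the determinant of this matrix has to be
    evaluated. Power series have no negative exponents, so a theta argument is kept as a pair (c, i)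
    standing for c q^i, and the bounds on i keep every exponent nonnegative. In class 0 the quotient
    is not zero; the moments vanish there because c_0 = 1 and 0^k = 0. *)

Record ser (R : comNzRingType) := Ser { coefs :> nat -> R }.

HB.instance Definition _ (R : comNzRingType) := gen_eqMixin (ser R).
HB.instance Definition _ (R : comNzRingType) := gen_choiceMixin (ser R).

Section SerRing.
Variable R : comNzRingType.
Implicit Types f g h : ser R.

Lemma serP f g : f =1 g -> f = g.
Proof. by case: f => f; case: g => g /= /funext ->. Qed.

Definition ser_add f g := Ser (fun n => f n + g n).
Definition ser_opp f := Ser (fun n => - f n).
Definition ser_zero : ser R := Ser (fun=> 0).
Definition ser_one : ser R := Ser (fun n => (n == 0)%:R).
Definition ser_mul f g := Ser (fun n => \sum_(i < n.+1) f i * g (n - i)%N).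

Lemma ser_addA : associative ser_add.
Proof. by move=> f g h; apply: serP => n /=; rewrite addrA. Qed.
Lemma ser_addC : commutative ser_add.
Proof. by move=> f g; apply: serP => n /=; rewrite addrC. Qed.
Lemma ser_add0 : left_id ser_zero ser_add.
Proof. by move=> f; apply: serP => n /=; rewrite add0r. Qed.
Lemma ser_addN : left_inverse ser_zero ser_opp ser_add.
Proof. by move=> f; apply: serP => n /=; rewrite addNr. Qed.

HB.instance Definition _ :=
  GRing.isZmodule.Build (ser R) ser_addA ser_addC ser_add0 ser_addN.

(** Up to q^N the Cauchy product is that of the truncations, so associativity and commutativity are
    inherited from polynomials. *)
Lemma ser_mul_poly N f g n : (n < N)%N ->
  ser_mul f g n = (\poly_(i < N) f i * \poly_(i < N) g i)`_n.
Proof.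
move=> nN; rewrite coefM /=; apply: eq_bigr => i _; have lt_in := ltn_ord i.
by rewrite !coef_poly !ifT //; lia.
Qed.

Lemma ser_mulA : associative ser_mul.
Proof.
move=> f g h; apply: serP => n.
rewrite !(@ser_mul_poly n.+1)//.
transitivity ((\poly_(i < n.+1) f i * (\poly_(i < n.+1) g i * \poly_(i < n.+1) h i))`_n).
  rewrite coefM [RHS]coefM; apply: eq_bigr => i _; have lt_in := ltn_ord i; rewrite [X in _ * X]coef_poly ifT; last by lia.
  by rewrite (@ser_mul_poly n.+1)//; lia.
rewrite mulrA coefM [RHS]coefM; apply: eq_bigr => i _; have lt_in := ltn_ord i; rewrite [X in _ = X * _]coef_poly ifT; last by lia.
by rewrite (@ser_mul_poly n.+1)//; lia.
Qed.

Lemma ser_mulC : commutative ser_mul.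
Proof. by move=> f g; apply: serP => n; rewrite !(@ser_mul_poly n.+1)// mulrC. Qed.

Lemma ser_mul1 : left_id ser_one ser_mul.
Proof.
move=> f; apply: serP => n /=.
by rewrite big_ord_recl /= mul1r subn0 big1 ?addr0// => i _; rewrite mul0r.
Qed.

Lemma ser_mulDl : left_distributive ser_mul ser_add.
Proof.
by move=> f g h; apply: serP => n /=; rewrite -big_split; apply: eq_bigr => i _; rewrite mulrDl.
Qed.

Lemma ser_oner_neq0 : ser_one != ser_zero.
Proof. by apply/eqP => /(congr1 (fun f : ser R => f 0%N)) /= /eqP; rewrite oner_eq0. Qed.

HB.instance Definition _ := GRing.Zmodule_isComNzRing.Build (ser R)
  ser_mulA ser_mulC ser_mul1 ser_mulDl ser_oner_neq0.

Arguments ser_mul : simpl never.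
Arguments ser_add : simpl never.
Arguments ser_opp : simpl never.

Lemma coef_serD f g n : (f + g) n = f n + g n. Proof. by []. Qed.
Lemma coef_serB f g n : (f - g) n = f n - g n. Proof. by []. Qed.
Lemma coef_serN f n : (- f) n = - f n. Proof. by []. Qed.
Lemma coef_ser1 n : (1 : ser R) n = (n == 0)%:R. Proof. by []. Qed.
Lemma coef_serM f g n : (f * g) n = \sum_(i < n.+1) f i * g (n - i)%N. Proof. by []. Qed.
Lemma coef_ser_sum I (r : seq I) (P : pred I) (F : I -> ser R) n :
  (\sum_(i <- r | P i) F i) n = \sum_(i <- r | P i) F i n.
Proof. by elim/big_rec2: _ => //= i x y _ <-. Qed.

Definition serC (c : R) : ser R := Ser (fun n => if n == 0%N then c else 0).

Lemma serC_is_additive : zmod_morphism serC.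
Proof. by move=> a b; apply: serP => -[|n]; rewrite coef_serB //= subrr. Qed.
Lemma coef_serCM c f n : (serC c * f) n = c * f n.
Proof. by rewrite coef_serM big_ord_recl /= subn0 big1 ?addr0// => i _; rewrite mul0r. Qed.
Lemma serC_is_multiplicative : monoid_morphism serC.
Proof.
split; first by apply: serP => -[].
by move=> a b; apply: serP => n; rewrite coef_serCM; case: n => [|n] //=; rewrite mulr0.
Qed.
HB.instance Definition _ := GRing.isZmodMorphism.Build R (ser R) serC serC_is_additive.
HB.instance Definition _ := GRing.isMonoidMorphism.Build R (ser R) serC serC_is_multiplicative.

Definition qX : ser R := Ser (fun n => (n == 1%N)%:R).

Lemma coef_qXnM e f n : (qX ^+ e * f) n = if (n < e)%N then 0 else f (n - e)%N.
Proof.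
elim: e n => [|e IH] n; first by rewrite expr0 mul1r subn0.
rewrite exprS -mulrA coef_serM; case: n => [|n].
  by rewrite big_ord_recl big_ord0 mul0r addr0.
rewrite big_ord_recl mul0r add0r big_ord_recl mul1r big1 ?addr0.
  by rewrite ltnS subSS -IH; congr (coefs _ _); rewrite /= /bump /=; lia.
by move=> i _; rewrite mul0r.
Qed.

Lemma coef_qXn e n : (qX ^+ e) n = (n == e)%:R.
Proof. by rewrite -[qX ^+ e]mulr1 coef_qXnM coef_ser1; case: ltngtP => h; rewrite ?subn_eq0 //; case: leqP => //; lia. Qed.

Lemma qXn_inj e f g : qX ^+ e * f = qX ^+ e * g -> f = g.
Proof.
move=> fg; apply: serP => n.
have := congr1 (fun h : ser R => h (e + n)%N) fg.
by rewrite !coef_qXnM ltnNge leq_addr /= addKn.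
Qed.

(** Congruence modulo q^N, through which infinite products are compared with finite ones. *)
Definition eqmod N f g := forall n, (n < N)%N -> f n = g n.

Lemma eqmodP f g : (forall N, eqmod N f g) -> f = g.
Proof. by move=> fg; apply: serP => n; apply: (fg n.+1). Qed.
Lemma eqmod_refl N f : eqmod N f f. Proof. by []. Qed.
Lemma eqmod_sym N f g : eqmod N f g -> eqmod N g f.
Proof. by move=> fg n nN; rewrite fg. Qed.
Lemma eqmod_trans N g f h : eqmod N f g -> eqmod N g h -> eqmod N f h.
Proof. by move=> fg gh n nN; rewrite fg ?gh. Qed.
Lemma eqmodW M N f g : (M <= N)%N -> eqmod N f g -> eqmod M f g.
Proof. by move=> MN fg n nM; apply: fg; apply: leq_trans MN. Qed.
Lemma eqmodD N f f' g g' : eqmod N f f' -> eqmod N g g' -> eqmod N (f + g) (f' + g').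
Proof. by move=> ff gg n nN; rewrite !coef_serD ff ?gg. Qed.
Lemma eqmodN N f f' : eqmod N f f' -> eqmod N (- f) (- f').
Proof. by move=> ff n nN; rewrite !coef_serN ff. Qed.
Lemma eqmodM N f f' g g' : eqmod N f f' -> eqmod N g g' -> eqmod N (f * g) (f' * g').
Proof.
move=> ff gg n nN; rewrite !coef_serM; apply: eq_bigr => i _; have lt_in := ltn_ord i.
by rewrite ff ?gg//; lia.
Qed.
Lemma eqmodMl N f g g' : eqmod N g g' -> eqmod N (f * g) (f * g').
Proof. exact: eqmodM. Qed.
Lemma eqmodMr N f f' g : eqmod N f f' -> eqmod N (f * g) (f' * g).
Proof. by move=> h; apply: eqmodM. Qed.
Lemma eqmod_sum N I (r : seq I) (P : pred I) (F G : I -> ser R) :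
  (forall i, P i -> eqmod N (F i) (G i)) ->
  eqmod N (\sum_(i <- r | P i) F i) (\sum_(i <- r | P i) G i).
Proof.
by move=> FG; elim/big_rec2: _ => // i x y Pi xy; apply: eqmodD => //; apply: FG.
Qed.
Lemma eqmod_prod N I (r : seq I) (P : pred I) (F G : I -> ser R) :
  (forall i, P i -> eqmod N (F i) (G i)) ->
  eqmod N (\prod_(i <- r | P i) F i) (\prod_(i <- r | P i) G i).
Proof.
by move=> FG; elim/big_rec2: _ => // i x y Pi xy; apply: eqmodM => //; apply: FG.
Qed.
Lemma eqmod_qXn0 N e f : (N <= e)%N -> eqmod N (qX ^+ e * f) 0.
Proof. by move=> Ne n nN; rewrite coef_qXnM ifT //; apply: leq_trans Ne. Qed.
Lemma eqmod_qXnM N M e f g : (N <= e + M)%N -> eqmod M f g ->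
  eqmod N (qX ^+ e * f) (qX ^+ e * g).
Proof. by move=> Ne fg n nN; rewrite !coef_qXnM; case: ltnP => // en; rewrite fg//; lia. Qed.

Lemma eqmod_cancel N (u v f g : ser R) : u * v = 1 -> eqmod N (u * f) (u * g) -> eqmod N f g.
Proof. by move=> uv /(eqmodMl v); rewrite !mulrA (mulrC v) uv !mul1r. Qed.

Definition iprod (F : nat -> ser R) : ser R := Ser (fun n => (\prod_(k < n.+1) F k) n).

(** The bound q^k is just enough for the first n+1 factors to fix the coefficient of q^n, and it
    lets in [poch c 0 1], whose factor k has exponent k. *)
Definition admissible (F : nat -> ser R) := forall k, eqmod k (F k) 1.

Lemma eqmod_prod_ge F N K : admissible F -> (N <= K)%N ->
  eqmod N (\prod_(k < K) F k) (\prod_(k < N) F k).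
Proof.
move=> aF NK; rewrite -(big_mkord xpredT) (big_cat_nat (n := N))//= big_mkord.
rewrite -[X in eqmod _ _ X]mulr1; apply: eqmodMl.
apply: (@eqmod_trans _ (\prod_(N <= i < K) 1)); last by rewrite big1.
rewrite !big_nat; apply: eqmod_prod => i /andP[Ni _].
exact: eqmodW (aF i).
Qed.

Lemma iprod_eqmod F N K : admissible F -> (N <= K)%N -> eqmod N (iprod F) (\prod_(k < K) F k).
Proof.
move=> aF NK n nN /=; apply/esym.
by apply: eqmod_prod_ge => //; apply: leq_trans NK.
Qed.

Lemma admM F G : admissible F -> admissible G -> admissible (fun k => F k * G k).
Proof. by move=> aF aG k; rewrite -[1]mulr1; apply: eqmodM. Qed.

Lemma iprodM F G : admissible F -> admissible G -> iprod (fun k => F k * G k) = iprod F * iprod G.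
Proof.
move=> aF aG; apply: eqmodP => N.
apply: eqmod_trans (iprod_eqmod (admM aF aG) (leqnn N)) _.
rewrite big_split; apply/eqmod_sym.
by apply: eqmodM; apply: iprod_eqmod.
Qed.

Lemma iprod1 : iprod (fun=> 1) = 1.
Proof. by apply: serP => n /=; rewrite big1. Qed.

Lemma eq_iprod F G : F =1 G -> iprod F = iprod G.
Proof. by move=> FG; apply: serP => n /=; under eq_bigr do rewrite FG. Qed.

Lemma iprod_eqP F f : admissible F -> (forall N, eqmod N f (\prod_(k < N) F k)) -> f = iprod F.
Proof.
move=> aF fF; apply: eqmodP => N; apply: eqmod_trans (fF N) _.
by apply/eqmod_sym/iprod_eqmod.
Qed.

Lemma iprod_bigprod I (r : seq I) (F : I -> nat -> ser R) :
  (forall i, admissible (F i)) ->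
  iprod (fun k => \prod_(i <- r) F i k) = \prod_(i <- r) iprod (F i).
Proof.
move=> aF; elim: r => [|i r IH].
  by rewrite big_nil -[RHS]iprod1; apply: eq_iprod => k; rewrite big_nil.
rewrite big_cons -IH -iprodM//; first by apply: eq_iprod => k; rewrite big_cons.
move=> k; elim: (r) => [|j s IHs]; first by rewrite big_nil.
by rewrite big_cons -[X in eqmod _ _ X]mulr1; apply: eqmodM => //; apply: aF.
Qed.

Definition fac c e : ser R := 1 - serC c * qX ^+ e.
Definition geo c e : ser R := Ser (fun n => if (e %| n)%N then c ^+ (n %/ e) else 0).

Lemma coef_fac c e n : fac c e n = (n == 0)%:R - c * (n == e)%:R.
Proof. by rewrite coef_serB coef_ser1 coef_serCM coef_qXn. Qed.

Lemma fac_geo c e : (0 < e)%N -> fac c e * geo c e = 1.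
Proof.
move=> e0; apply: serP => n; rewrite mulrBl mul1r coef_serB -mulrA coef_serCM coef_qXnM coef_ser1 /=.
case: ltnP => ne.
  rewrite mulr0 subr0; case: n ne => [|n] ne; first by rewrite dvdn0 div0n.
  by rewrite gtnNdvd.
rewrite dvdn_subl ?dvdnn//; case: ifP => en; last by rewrite mulr0 subrr; case: n {en} ne => //; lia.
have -> : (n %/ e = ((n - e) %/ e).+1)%N by rewrite -{1}(subnK ne) divnDr// divnn e0 addn1.
by rewrite exprS subrr; case: n ne {en} => //; lia.
Qed.

Lemma eqmod_fac N c e : (N <= e)%N -> eqmod N (fac c e) 1.
Proof. by move=> Ne n nN; rewrite coef_fac coef_ser1 (_ : (n == e) = false) ?mulr0 ?subr0//; lia. Qed.
Lemma eqmod_geo N c e : (0 < e)%N -> (N <= e)%N -> eqmod N (geo c e) 1.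
Proof.
move=> e0 Ne n nN; rewrite coef_ser1 /=; case: n nN => [|n] nN; first by rewrite dvdn0 div0n.
by rewrite gtnNdvd//; apply: leq_trans Ne.
Qed.

(** The symbol (c q^a; q^m)_oo; [ipoch] is its reciprocal for a > 0. *)
Definition poch c a m := iprod (fun k => fac c (a + m * k)).
Definition ipoch c a m := iprod (fun k => geo c (a + m * k)).

Lemma adm_fac c a m : (0 < m)%N -> admissible (fun k => fac c (a + m * k)).
Proof. by move=> m0 k; apply: eqmod_fac; nia. Qed.
Lemma adm_geo c a m : (0 < a)%N -> (0 < m)%N -> admissible (fun k => geo c (a + m * k)).
Proof. by move=> a0 m0 k; apply: eqmod_geo; nia. Qed.
Lemma poch_ipoch c a m : (0 < a)%N -> (0 < m)%N -> poch c a m * ipoch c a m = 1.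
Proof.
move=> a0 m0; rewrite -iprodM; [|exact: adm_fac|exact: adm_geo].
by rewrite -[RHS]iprod1; apply: eq_iprod => k; rewrite fac_geo//; nia.
Qed.

Lemma poch_rec c a m : (0 < m)%N -> poch c a m = fac c a * poch c (a + m) m.
Proof.
move=> m0; apply/esym/iprod_eqP; first exact: adm_fac.
case=> [|N]; first by [].
rewrite big_ord_recl muln0 addn0; apply: eqmodMl.
have -> : \prod_(i < N) fac c (a + m * lift ord0 i) = \prod_(i < N) fac c (a + m + m * i).
  by apply: eq_bigr => i _; congr fac; rewrite /= /bump; lia.
apply: eqmod_trans (iprod_eqmod (adm_fac _ _ m0) (leqnSn N.+1)) _.
rewrite !big_ord_recr /= -mulrA -[X in eqmod _ _ X]mulr1; apply: eqmodMl.
by rewrite -[1]mulr1; apply: eqmodM; apply: eqmod_fac; nia.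
Qed.

End SerRing.
Arguments qX {R}.

(** * Formal sums over arbitrary index types *)

Section FormalSum.
Variable R : comNzRingType.

(* Formal sum of the monomials [c j q^(e j)]; negative exponents are dropped, and
   [proper] makes each coefficient a finite sum (otherwise fsbigop returns 0). *)
Definition gsum (I : choiceType) (c : I -> R) (e : I -> int) : ser R :=
  Ser (fun n => \sum_(j \in [set: I]) (if e j == n%:Z then c j else 0)).

Definition proper (I : choiceType) (e : I -> int) :=
  forall n : nat, exists s : seq I, forall j, e j <= n%:Z -> j \in s.

Lemma gsumE (I : choiceType) (c : I -> R) e n (s : seq I) :
  uniq s -> (forall j, e j = n%:Z -> j \in s) ->
  gsum c e n = \sum_(j <- s | e j == n%:Z) c j.
Proof.
move=> us es; rewrite /gsum /= (fsbigE s)//.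
  by rewrite [RHS]big_mkcond; apply: eq_bigl => i; rewrite in_setT.
by move=> i _ /negP si; case: eqP => // /es.
Qed.

Lemma proper_uniq (I : choiceType) (e : I -> int) (n : nat) : proper e ->
  exists2 s : seq I, uniq s & forall j, e j <= n%:Z -> j \in s.
Proof.
move=> /(_ n)[s sP]; exists (undup s); first exact: undup_uniq.
by move=> j /sP; rewrite mem_undup.
Qed.

Lemma eq_gsum (I : choiceType) (c c' : I -> R) e e' : c =1 c' -> e =1 e' -> gsum c e = gsum c' e'.
Proof. by move=> /funext -> /funext ->. Qed.

Lemma gsum_reindex (I J : choiceType) (h : J -> I) (c : I -> R) e : bijective h ->
  gsum c e = gsum (c \o h) (e \o h).
Proof. by move=> bh; apply: serP => n; rewrite /gsum /= (@reindex_fsbigT _ _ _ _ _ h). Qed.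

(** The sign conditions matter: a monomial dropped from one factor for its negative exponent could
    still reach a nonnegative exponent in a pair. *)
Lemma gsumM (I J : choiceType) (c : I -> R) e (d : J -> R) f :
  proper e -> proper f -> (forall i, 0 <= e i) -> (forall j, 0 <= f j) ->
  gsum c e * gsum d f = gsum (fun p : I * J => c p.1 * d p.2) (fun p => e p.1 + f p.2).
Proof.
move=> pe pf e0 f0; apply: serP => n.
have [s us sP] := proper_uniq n pe; have [t ut tP] := proper_uniq n pf.
rewrite coef_serM (@gsumE _ _ _ _ [seq (i, j) | i <- s, j <- t]); first last.
- case=> i j /= ij; apply/allpairsP; exists (i, j); split=> //=.
    by apply: sP; have := f0 j; lia.
  by apply: tP; have := e0 i; lia.
- by apply: allpairs_uniq => // -[? ?] [? ?].
rewrite [RHS]big_mkcond big_allpairs.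
transitivity (\sum_(k < n.+1) \sum_(i <- s) \sum_(j <- t)
   (if (e i == k%:Z) && (f j == (n - k)%N%:Z) then c i * d j else 0)).
  apply: eq_bigr => k _; have lt_kn := ltn_ord k.
  rewrite (@gsumE _ _ _ _ s)//; last by move=> i ei; apply: sP; lia.
  rewrite (@gsumE _ _ _ _ t)//; last by move=> i ei; apply: tP; lia.
  rewrite big_distrl big_mkcond; apply: eq_bigr => i _ /=; case: eqP => _ /=; last by rewrite big1.
  by rewrite big_distrr big_mkcond.
rewrite exchange_big; apply: eq_bigr => i _; rewrite exchange_big; apply: eq_bigr => j _ /=.
case: eqP => ij.
  have kn : (`|e i| < n.+1)%N by have := e0 i; have := f0 j; lia.
  rewrite (bigD1 (Ordinal kn))//= ifT; last by have := e0 i; have := f0 j; lia.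
  rewrite big1 ?addr0// => k /eqP nk; rewrite ifF//; apply/negP => /andP[/eqP ek _].
  by apply: nk; apply: val_inj; rewrite /= ek.
by rewrite big1// => k _; have := ltn_ord k => kn; rewrite ifF//; apply/negP => /andP[/eqP ? /eqP ?]; lia.
Qed.

(** The source of all dissections below: [h] lists p cosets of a sublattice of the index set, with
    [J] as coordinates inside each coset. *)
Lemma gsum_split (I J : choiceType) (p : nat) (h : 'I_p * J -> I) (c : I -> R) e :
  bijective h -> proper e ->
  gsum c e = \sum_(r < p) gsum (fun j => c (h (r, j))) (fun j => e (h (r, j))).
Proof.
move=> bh pe; rewrite (gsum_reindex _ _ bh); apply: serP => n; rewrite coef_ser_sum.
have [s us sP] := proper_uniq n pe.
case: bh => g hg gh; pose t := undup [seq (g i).2 | i <- s].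
have tP r j : e (h (r, j)) = n%:Z -> j \in t.
  move=> ej; rewrite mem_undup; apply/mapP; exists (h (r, j)); last by rewrite hg.
  by apply: sP; rewrite ej.
rewrite (@gsumE _ _ _ _ [seq (r, j) | r <- index_enum 'I_p, j <- t]); first last.
- by case=> r j /= ej; apply/allpairsP; exists (r, j); rewrite mem_index_enum (tP r).
- by apply: allpairs_uniq; rewrite ?index_enum_uniq ?undup_uniq// => -[? ?] [? ?].
rewrite [LHS]big_mkcond big_allpairs; apply: eq_bigr => r _.
rewrite (@gsumE _ _ _ _ t) ?undup_uniq//; first by rewrite [RHS]big_mkcond.
exact: tP.
Qed.

Lemma gsumZ (I : choiceType) a (c : I -> R) e : proper e -> serC a * gsum c e = gsum (fun j => a * c j) e.
Proof.
move=> pe; apply: serP => n; rewrite coef_serCM; have [s us sP] := proper_uniq n pe.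
by rewrite !(@gsumE _ _ _ _ s) ?big_distrr// => j ej; apply: sP; rewrite ej.
Qed.

Lemma gsumX (I : choiceType) k (c : I -> R) e : (forall i, 0 <= e i) ->
  qX ^+ k * gsum c e = gsum c (fun j => k%:Z + e j).
Proof.
move=> e0; apply: serP => n; rewrite coef_qXnM; case: ltnP => kn.
  by rewrite /= fsbig1// => i _; rewrite ifF//; have := e0 i; lia.
by rewrite /gsum /=; apply: eq_fsbigr => i _; congr (if _ then _ else _); lia.
Qed.

End FormalSum.

Definition binz (j : int) : int := ((j * (j - 1)) %/ 2)%Z.

Lemma binzE j : 2 * binz j = j * (j - 1).
Proof.
have [k [->|->]] : exists k, j = 2 * k \/ j = 2 * k + 1 by exists (j %/ 2)%Z; lia.
  by rewrite /binz (_ : 2 * k * (2 * k - 1) = (k * (2 * k - 1)) * 2) ?mulzK//; ring.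
by rewrite /binz (_ : (2 * k + 1) * (2 * k + 1 - 1) = ((2 * k + 1) * k) * 2) ?mulzK//; ring.
Qed.

Lemma binz_ge0 j : 0 <= binz j.
Proof. by have := binzE j; nia. Qed.

Section Theta.
Variable R : fieldType.
Implicit Types c : R.

(* [sum_(j in Z) c^j q^(e + i j + m j (j - 1) / 2)] *)
Definition th (c : R) (e i m : int) : ser R :=
  gsum (fun j : int => c ^ j) (fun j => e + i * j + m * binz j).

(** Quadratic growth: beyond |j| = B the term m binz j outweighs |i| |j| + |e| + n. *)
Lemma proper_th (e i m : int) : 0 < m -> proper (fun j : int => e + i * j + m * binz j).
Proof.
move=> m0 n; pose B : int := 3 + 2 * (`|i| + `|e| + n%:Z).
have B0 : 0 <= B by rewrite /B; lia.
exists [seq k%:Z - B | k <- iota 0 (2 * `|B|).+1] => j jn.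
have [jB|jB] := lerP `|j| B.
  apply/mapP; exists `|(j + B)%R|%N; last by lia.
  by rewrite mem_iota; lia.
have h1 : `|j| * (`|j| - 1) <= 2 * binz j by rewrite binzE; nia.
have h2 : - (`|i| * `|j|) <= i * j by have [] := (lerP 0 i, lerP 0 j); nia.
have h3 : `|j| * (2 + 2 * (`|i| + `|e| + n%:Z)) <= 2 * binz j.
  by apply: le_trans h1; apply: ler_wpM2l; rewrite // /B in jB *; lia.
have h4 : binz j <= m * binz j by have := binz_ge0 j; nia.
have : `|j| * (1 + `|e| + n%:Z) <= n%:Z - e by lia.
have : 1 * (1 + `|e| + n%:Z) <= `|j| * (1 + `|e| + n%:Z) by apply: ler_wpM2r; lia.
by lia.
Qed.
End Theta.

(** * The Jacobi triple product *)

Section FiniteJTP.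
Variable A : comNzRingType.
Variable Q : A.

(** The Gaussian binomial coefficient in base Q, by a q-Pascal rule rather than as a quotient. The
    truncated subtraction n' - k' is harmless: for k' > n' the power multiplies 0. *)
Fixpoint gbin n k : A :=
  match n, k with
  | _, 0%N => 1
  | 0%N, _.+1 => 0
  | n'.+1, k'.+1 => gbin n' k + Q ^+ (n' - k') * gbin n' k'
  end.

Lemma gbin0 n : gbin n 0 = 1. Proof. by case: n. Qed.
Lemma gbinS n k : gbin n.+1 k.+1 = gbin n k.+1 + Q ^+ (n - k) * gbin n k.
Proof. by []. Qed.
Lemma gbin_small n k : (n < k)%N -> gbin n k = 0.
Proof.
elim: n k => [|n IH] [|k] //; rewrite ltnS => nk.
by rewrite gbinS !IH ?mulr0 ?addr0// leqW.
Qed.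
Lemma gbinn n : gbin n n = 1.
Proof. by elim: n => // n IH; rewrite gbinS gbin_small// subnn mul1r add0r. Qed.

Arguments gbin : simpl never.

(** The other q-Pascal rule: it absorbs a new factor on the y side in [finite_jtp], as [gbinS] does
    on the x side. *)
Lemma gbinS' n k : gbin n.+1 k.+1 = Q ^+ k.+1 * gbin n k.+1 + gbin n k.
Proof.
elim: n k => [|n IH] k; first by case: k => [|k]; rewrite /gbin !(mulr0, mulr1, addr0, add0r).
have [nk|kn] := ltnP n k.
  move: nk; rewrite leq_eqVlt => /predU1P[<-|nk].
    by rewrite (gbin_small (n := n.+1) (k := n.+2))// !gbinn mulr0 add0r.
  by rewrite !gbin_small ?mulr0 ?addr0//; lia.
rewrite gbinS [in LHS]IH [in RHS]gbinS.
case: k kn => [|k] kn.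
  by rewrite !gbin0 !subn0 [Q ^+ n.+1]exprS; ring.
rewrite [X in _ + _ * X = _]IH [in X in _ = _ + X]gbinS.
have -> : (n.+1 - k.+1 = n - k)%N by lia.
have E : Q ^+ (n - k) * Q ^+ k.+1 = Q ^+ k.+2 * Q ^+ (n - k.+1).
  by rewrite -!exprD; congr (_ ^+ _); lia.
by rewrite !mulrDr !mulrA E; ring.
Qed.

Lemma gbin_fact k l : gbin (k + l) k * \prod_(i < k) (1 - Q ^+ i.+1) * \prod_(i < l) (1 - Q ^+ i.+1)
  = \prod_(i < k + l) (1 - Q ^+ i.+1).
Proof.
have [n] := ubnP (k + l); elim: n k l => // n IH [|k] [|l] kl.
- by rewrite !big_ord0 !mulr1.
- by rewrite add0n gbin0 big_ord0 !mul1r.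
- by rewrite addn0 gbinn big_ord0 mul1r mulr1.
have IH1 := IH k.+1 l; have IH2 := IH k l.+1.
rewrite addSn gbinS addnS; have -> : ((k + l).+1 - k = l.+1)%N by lia.
move: IH1 IH2; rewrite addSn addnS => /(_ ltac:(lia)) IH1 /(_ ltac:(lia)) IH2.
have Pr m : \prod_(i < m.+1) (1 - Q ^+ i.+1) = \prod_(i < m) (1 - Q ^+ i.+1) * (1 - Q ^+ m.+1).
  by rewrite big_ord_recr.
rewrite [in RHS]Pr -IH1; move: IH2; rewrite -IH1 !Pr => IH2.
set P := \prod_(i < k) _ in IH2 *; set S := \prod_(i < l) _ in IH2 *.
have -> : (k + l).+2 = (l.+1 + k.+1)%N by lia.
rewrite exprD.
have -> : (gbin (k + l).+1 k.+1 + Q ^+ l.+1 * gbin (k + l).+1 k) * (P * (1 - Q ^+ k.+1)) * (S * (1 - Q ^+ l.+1))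
  = gbin (k + l).+1 k.+1 * (P * (1 - Q ^+ k.+1)) * S * (1 - Q ^+ l.+1)
   + Q ^+ l.+1 * (1 - Q ^+ k.+1) * (gbin (k + l).+1 k * P * (S * (1 - Q ^+ l.+1))) by ring.
by rewrite IH2; ring.
Qed.

(* [x y = Q], and [t j] is [x^j Q^(j (j - 1) / 2)], that is [y^(-j) Q^(j (j + 1) / 2)]:
   the hypotheses avoid dividing by [x]. *)
Variables (x y : A) (t : int -> A).
Hypothesis t0 : t 0 = 1.
Hypothesis t_x : forall (a : nat) (j : int), j <= a%:Z -> x * Q ^+ a * t j = Q ^+ `|a%:Z - j| * t (j + 1).
Hypothesis t_y : forall (b : nat) (j : int), - b%:Z <= j -> y * Q ^+ b * t j = Q ^+ `|b%:Z + j| * t (j - 1).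

(** Induction on the number of factors: a new factor moves t j to its neighbour, and the two
    resulting sums recombine by a q-Pascal rule. *)
Lemma finite_jtp a b :
  \prod_(k < a) (1 + x * Q ^+ k) * \prod_(k < b) (1 + y * Q ^+ k) =
  \sum_(k < (a + b).+1) gbin (a + b) k * t (k%:Z - b%:Z).
Proof.
elim: b => [|b IH].
  elim: a => [|a IH]; first by rewrite !big_ord0 big_ord_recl big_ord0 /= subrr t0 !mulr1 addr0.
  rewrite big_ord_recr /= big_ord0 mulr1 mulrDr mulr1; move: IH; rewrite big_ord0 mulr1 !addn0 => ->.
  rewrite mulr_suml [RHS]big_ord_recl gbin0.
  under [in RHS]eq_bigr do rewrite lift0 gbinS mulrDl.
  rewrite big_split /= addrA; congr (_ + _).
    rewrite [X in _ = _ + X]big_ord_recr /= gbin_small// mul0r addr0 big_ord_recl gbin0 ?addr0.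
    by congr (_ + _); apply: eq_bigr => i _; rewrite lift0.
  apply: eq_bigr => i _; have li := ltn_ord i.
  rewrite -mulrA (mulrC _ (x * _)) t_x; last by lia.
  rewrite mulrCA mulrA; congr (_ * _ * t _); last by lia.
  by congr (_ ^+ _); lia.
rewrite big_ord_recr /= mulrA IH mulrDr mulr1 addnS [RHS]big_ord_recl gbin0.
under [in RHS]eq_bigr do rewrite lift0 gbinS' mulrDl.
rewrite big_split /= addrA [X in _ = _ + X](_ : _ = \sum_(k < (a + b).+1) gbin (a + b) k * t (k%:Z - b%:Z)); last first.
  by apply: eq_bigr => i _; congr (_ * t _); lia.
rewrite [LHS]addrC; congr (_ + _).
rewrite [X in _ = _ + X]big_ord_recr /= gbin_small// mulr0 mul0r addr0 mulr_suml big_ord_recl gbin0.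
congr (_ + _).
  rewrite !mul1r mulrC t_y /=; last by lia.
  by rewrite (_ : `|_|%N = 0%N) ?mul1r; [congr t; lia|lia].
apply: eq_bigr => i _; rewrite lift0 -mulrA (mulrC _ (y * _)) t_y; last by lia.
rewrite mulrCA mulrA; congr (_ * _ * t _); last by lia.
by congr (_ ^+ _); lia.
Qed.
End FiniteJTP.

Section JTP.
Variable R : fieldType.
Implicit Types c : R.

Lemma th_exp_ge0 (i m j : int) : 0 <= i <= m -> 0 <= i * j + m * binz j.
Proof.
move=> /andP[i0 im]; have := binzE j; have := binz_ge0 j.
have [j0|j0] := lerP 0 j; first by nia.
move=> b0 bE; have h : 0 <= binz j + j by nia.
have : m * j <= i * j by apply: ler_wnM2r; [exact: ltW|].
have : 0 <= m * (binz j + j) by apply: mulr_ge0 => //; lia.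
lia.
Qed.

Lemma binzS (j : int) : binz (j + 1) = binz j + j.
Proof. by apply: (mulfI (x := 2)) => //; rewrite mulrDr !binzE; ring. Qed.

Lemma qX_poch (m N : nat) : (0 < m)%N ->
  eqmod (m * N.+1) (poch (1 : R) m m) (\prod_(k < N) (1 - (qX ^+ m) ^+ k.+1)).
Proof.
move=> m0; have E k : 1 - (qX ^+ m) ^+ k.+1 = fac (1 : R) (m + m * k).
  by rewrite /fac rmorph1 mul1r -exprM mulnS.
under eq_bigr do rewrite E.
have [NN|NN] := leqP (m * N.+1) N; first exact: (iprod_eqmod (adm_fac _ _ m0)).
apply: eqmod_trans (iprod_eqmod (adm_fac _ _ m0) (leqnn _)) _.
rewrite -(big_mkord xpredT (fun k => fac (1 : R) (m + m * k))) (big_cat_nat (n := N))//=; last exact: ltnW.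
rewrite big_mkord -[X in eqmod _ _ X]mulr1; apply: eqmodMl.
apply: (@eqmod_trans _ _ (\prod_(N <= i < m * N.+1) 1)); last by rewrite big1.
rewrite !big_nat; apply: eqmod_prod => i /andP[Ni _]; apply: eqmod_fac; nia.
Qed.

(** By [gbin_fact] the coefficient is (Q)_n / ((Q)_k (Q)_(n-k)) with Q = q^m, and each finite
    product agrees with (Q)_oo up to its first missing factor. *)
Lemma poch_gbin (m n k : nat) : (0 < m)%N -> (k <= n)%N ->
  eqmod (m * (minn k (n - k)).+1) (poch (1 : R) m m * gbin (qX ^+ m) n k) 1.
Proof.
move=> m0 kn; set J := poch _ _ _; set N := (m * _)%N.
have JJ : J * ipoch 1 m m = 1 by apply: poch_ipoch.
apply: (eqmod_cancel JJ); rewrite mulr1.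
have E l : (minn k (n - k) <= l)%N -> eqmod N J (\prod_(i < l) (1 - (qX ^+ m) ^+ i.+1)).
  by move=> hl; apply: (@eqmodW _ _ (m * l.+1)); [rewrite /N; nia|apply: qX_poch].
apply: (@eqmod_trans _ _ (\prod_(i < n) (1 - (qX ^+ m) ^+ i.+1))); last by apply/eqmod_sym/E; lia.
rewrite -[in X in eqmod _ _ X](subnKC kn) -gbin_fact subnKC// mulrA mulrC -mulrA.
by apply: eqmodMl; apply: eqmodM; apply: E; lia.
Qed.

(** This is the limit of [finite_jtp] at x = - c q^i, y = - c^-1 q^(m-i), Q = q^m, with N factors on
    each side, multiplied by (Q)_oo and read modulo q^N. *)
Theorem jtp c (i m : nat) : c != 0 -> (0 < m)%N -> (i <= m)%N ->
  th (- c) 0 i%:Z m%:Z = poch 1 m m * poch c i m * poch c^-1 (m - i) m.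
Proof.
move=> c0 m0 im; pose e (j : int) : int := i%:Z * j + m%:Z * binz j.
have e0 j : 0 <= e j by apply: th_exp_ge0; lia.
pose t (j : int) : ser R := serC ((- c) ^ j) * qX ^+ `|e j|.
have nc0 : - c != 0 by rewrite oppr_eq0.
have tx (a : nat) (j : int) : j <= a%:Z ->
    - (serC c * qX ^+ i) * (qX ^+ m) ^+ a * t j = (qX ^+ m) ^+ `|a%:Z - j| * t (j + 1).
  move=> ja; rewrite /t expfzDr// expr1z rmorphM rmorphN -!exprM.
  have E : qX ^+ i * qX ^+ (m * a) * qX ^+ `|e j| = qX ^+ (m * `|(a%:Z - j)%R|) * qX ^+ `|e (j + 1)| :> ser R.
    rewrite -!exprD; congr (_ ^+ _); have := e0 j; have := e0 (j + 1); rewrite /e binzS.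
    have -> : (m * `|(a%:Z - j)%R|)%N = `|(m%:Z * (a%:Z - j))%R|%N by rewrite abszM.
    have : 0 <= m%:Z * (a%:Z - j) by apply: mulr_ge0; lia.
    move: (binz j) => b; rewrite !mulrDr !mulrN !mulr1; move: (m%:Z * j) (i%:Z * j) (m%:Z * b) => u v w; lia.
  transitivity (serC ((- c) ^ j) * - serC c * (qX ^+ i * qX ^+ (m * a) * qX ^+ `|e j|)); first by ring.
  by rewrite E; ring.
have ty (b : nat) (j : int) : - b%:Z <= j ->
    - (serC c^-1 * qX ^+ (m - i)) * (qX ^+ m) ^+ b * t j = (qX ^+ m) ^+ `|b%:Z + j| * t (j - 1).
  move=> ja; rewrite /t.
  have -> : (- c) ^ (j - 1) = (- c) ^ j * - c^-1 by rewrite expfzDr// -invrN.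
  rewrite rmorphM rmorphN -!exprM.
  have E : qX ^+ (m - i) * qX ^+ (m * b) * qX ^+ `|e j| = qX ^+ (m * `|(b%:Z + j)%R|) * qX ^+ `|e (j - 1)| :> ser R.
    rewrite -!exprD; congr (_ ^+ _); have := e0 j; have := e0 (j - 1).
    have -> : e j = e (j - 1) + i%:Z + m%:Z * (j - 1) by rewrite /e -{2}(subrK 1 j) binzS; ring.
    have -> : (m * `|(b%:Z + j)%R|)%N = `|(m%:Z * (b%:Z + j))%R|%N by rewrite abszM.
    have : 0 <= m%:Z * (b%:Z + j) by apply: mulr_ge0; lia.
    rewrite !mulrDr !mulrN !mulr1; move: (m%:Z * j) (e _) => u v; lia.
  transitivity (serC ((- c) ^ j) * - serC c^-1 * (qX ^+ (m - i) * qX ^+ (m * b) * qX ^+ `|e j|)); first by ring.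
  by rewrite E; ring.
have t0 : t 0 = 1 by rewrite /t /e (_ : binz 0 = 0)// !mulr0 addr0 expr0z rmorph1 mul1r.
apply: eqmodP => N.
have fin := finite_jtp t0 tx ty N N.
have e_big j : N%:Z < `|j| -> N%:Z <= e j.
  move=> jN; rewrite /e; have := binzE j; have := binz_ge0 j.
  have [j0|j0] := lerP 0 j => b0 bE.
    have h : N%:Z <= binz j by nia.
    have h1 : 0 <= i%:Z * j by apply: mulr_ge0.
    have h2 : binz j <= m%:Z * binz j by nia.
    lia.
  have h : N%:Z <= binz j + j by nia.
  have h1 : m%:Z * j <= i%:Z * j by apply: ler_wnM2r; lia.
  have h2 : binz j + j <= m%:Z * (binz j + j) by nia.
  lia.
apply: (@eqmod_trans _ _ (\sum_(k < (N + N).+1) t (k%:Z - N%:Z))).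
  move=> n nN; rewrite coef_ser_sum /th (@gsumE _ _ _ _ _ [seq k%:Z - N%:Z | k <- iota 0 (N + N).+1]); first last.
  - move=> j ej; apply/mapP; exists `|(j + N%:Z)%R|%N; last first.
      by have [/e_big|] := ltrP N%:Z `|j|; [rewrite /e|]; lia.
    by rewrite mem_iota; have [/e_big|] := ltrP N%:Z `|j|; [rewrite /e|]; lia.
  - by rewrite map_inj_uniq ?iota_uniq// => a b; lia.
  rewrite big_mkcond big_map -[iota _ _]/(index_iota 0 (N + N).+1) big_mkord; apply: eq_bigr => k _.
  rewrite /t coef_serCM coef_qXn -/(e _); move: (e0 (k%:Z - N%:Z)); rewrite /e.
  by case: eqP => [|]; case: eqP; rewrite ?mulr1 ?mulr0//; lia.
apply: (@eqmod_trans _ _ (poch 1 m m * \sum_(k < (N + N).+1) gbin (qX ^+ m) (N + N) k * t (k%:Z - N%:Z))).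
  rewrite mulr_sumr; apply: eqmod_sum => k _; rewrite mulrA.
  have lk := ltn_ord k.
  rewrite -[X in eqmod _ X _]mul1r /t !(mulrCA _ (serC _)); apply: eqmodMl; rewrite ![_ * qX ^+ _]mulrC.
  apply: eqmod_qXnM; last by apply/eqmod_sym/poch_gbin.
  (* Near the ends of the range the Gaussian binomial is accurate only to order m (N - |j| + 1); the
     exponent of t j supplies the missing order. *)
  have := e0 (k%:Z - N%:Z); rewrite /e; set j := k%:Z - N%:Z => ej0.
  have h : N%:Z <= i%:Z * j + m%:Z * binz j + m%:Z * (N%:Z - `|j| + 1).
    have := binzE j; have := binz_ge0 j.
    have jN : `|j| <= N%:Z by rewrite /j; lia.
    have [j0|j0] := lerP 0 j => b0 bE.
      have h : -1 <= binz j - j by nia.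
      have h1 : 0 <= i%:Z * j by apply: mulr_ge0.
      have h2 : 1 * (binz j + (N%:Z - j + 1)) <= m%:Z * (binz j + (N%:Z - j + 1)).
        by apply: ler_wpM2r; lia.
      by rewrite mulrDr in h2; lia.
    have h : -1 <= binz j + j + j by nia.
    have h1 : m%:Z * j <= i%:Z * j by apply: ler_wnM2r; lia.
    have h2 : 1 * (j + binz j + (N%:Z + j + 1)) <= m%:Z * (j + binz j + (N%:Z + j + 1)).
      by apply: ler_wpM2r; lia.
    by rewrite ltr0_norm// opprK; lia.
  have -> : (m * (minn k (N + N - k)).+1)%N = `|(m%:Z * (N%:Z - `|j| + 1))%R|%N.
    by rewrite abszM; congr (_ * _)%N; rewrite /j; lia.
  have : 0 <= m%:Z * (N%:Z - `|j| + 1) by apply: mulr_ge0; rewrite /j; lia.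
  lia.
rewrite -fin -!mulrA; apply: eqmodMl.
have E (d : R) l k : 1 + - (serC d * qX ^+ l) * (qX ^+ m) ^+ k = fac d (l + m * k).
  by rewrite /fac exprD exprM; ring.
rewrite (eq_bigr _ (fun (k : 'I_N) _ => E c i k)) (eq_bigr _ (fun (k : 'I_N) _ => E c^-1 (m - i)%N k)).
by apply: eqmod_sym; apply: eqmodM; apply: iprod_eqmod (leqnn _); apply: adm_fac.
Qed.

End JTP.

(** * Products of theta series *)

Section ThetaTheory.
Variable R : fieldType.
Implicit Types a b c : R.

(** Multiplying [binzE] by m turns the nonlinear monomials into atoms that [lia] can match
    linearly. *)
Ltac binz_lia m :=
  repeat match goal with |- context [binz ?u] =>
    let b := fresh "b" in have := congr1 (fun z : int => m * z) (binzE u);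
    move: (binz u) => b end;
  rewrite /bump /=; lia.

Lemma properD (I J : choiceType) (e : I -> int) (f : J -> int) :
  proper e -> proper f -> (forall i, 0 <= e i) -> (forall j, 0 <= f j) ->
  proper (fun p : I * J => e p.1 + f p.2).
Proof.
move=> pe pf e0 f0 n; have [s sP] := pe n; have [t tP] := pf n.
exists [seq (i, j) | i <- s, j <- t] => -[i j] /= ij; apply/allpairsP; exists (i, j).
by split=> //=; [apply: sP; have := f0 j|apply: tP; have := e0 i]; lia.
Qed.

Lemma binzD (j k : int) : binz (j + k) = binz j + binz k + j * k.
Proof. by apply: (mulfI (x := 2)) => //; rewrite !mulrDr !binzE; ring. Qed.

(** The index shift j -> j + 1 brings the linear coefficient back into the range [0, m] of
    [th_exp_ge0]. *)
Lemma th_exp_ge0' (e i m j : int) : 0 <= m -> m <= i <= 2 * m -> i <= e + m -> 0 <= e + i * j + m * binz j.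
Proof.
move=> m0 im ie; have -> : e + i * j + m * binz j = (e + m - i) + ((i - m) * (j + 1) + m * binz (j + 1)).
  by rewrite binzS; ring.
by apply: addr_ge0; [lia|apply: th_exp_ge0; lia].
Qed.

Lemma th_shift (t : int) c e i m : c != 0 -> 0 < m ->
  th c e i m = serC (c ^ t) * th c (e + i * t + m * binz t) (i + m * t) m.
Proof.
move=> c0 m0; rewrite gsumZ; last exact: proper_th.
rewrite /th (@gsum_reindex _ _ _ (fun j : int => j + t)); last first.
  by exists (fun j => j - t) => j; rewrite ?addrK ?subrK.
apply: eq_gsum => j /=; first by rewrite addrC expfzDr.
by rewrite binzD; ring.
Qed.

Lemma th_refl c e i m : th c e i m = th c^-1 e (m - i) m.
Proof.
rewrite /th (@gsum_reindex _ _ _ (fun j : int => - j)); last first.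
  by exists (fun j => - j) => j; rewrite opprK.
apply: eq_gsum => j /=; first by rewrite exprz_inv.
have -> : binz (- j) = binz j + j by apply: (mulfI (x := 2)) => //; rewrite mulrDr !binzE; ring.
ring.
Qed.

Lemma th_qX (k : nat) c (e i m : int) : (forall j, 0 <= e + i * j + m * binz j) ->
  qX ^+ k * th c e i m = th c (k%:Z + e) i m.
Proof. by move=> h; rewrite gsumX//; apply: eq_gsum => // j; ring. Qed.

Lemma th_qX0 (k : nat) c (i m : int) : 0 <= i <= m ->
  qX ^+ k * th c 0 i m = th c k%:Z i m.
Proof. by move=> h; rewrite th_qX ?addr0// => j; rewrite add0r; apply: th_exp_ge0. Qed.

Lemma th_mulE a e i m b f j k : 0 < m -> 0 < k ->
  (forall l, 0 <= e + i * l + m * binz l) -> (forall l, 0 <= f + j * l + k * binz l) ->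
  th a e i m * th b f j k =
  gsum (fun p : int * int => a ^ p.1 * b ^ p.2)
       (fun p => (e + i * p.1 + m * binz p.1) + (f + j * p.2 + k * binz p.2)).
Proof. by move=> m0 k0 h1 h2; rewrite gsumM//; apply: proper_th. Qed.

Lemma th_mulZE x a e i m b f j k : 0 < m -> 0 < k ->
  (forall l, 0 <= e + i * l + m * binz l) -> (forall l, 0 <= f + j * l + k * binz l) ->
  serC x * (th a e i m * th b f j k) =
  gsum (fun p : int * int => x * (a ^ p.1 * b ^ p.2))
       (fun p => (e + i * p.1 + m * binz p.1) + (f + j * p.2 + k * binz p.2)).
Proof.
move=> m0 k0 h1 h2; rewrite th_mulE// gsumZ//.
by apply: (@properD _ _ (fun l => e + i * l + m * binz l) (fun l => f + j * l + k * binz l)) => //; apply: proper_th.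
Qed.

Lemma th_mul_split p (h : 'I_p * (int * int) -> int * int) a e i m b f j k :
  bijective h -> 0 < m -> 0 < k ->
  (forall l, 0 <= e + i * l + m * binz l) -> (forall l, 0 <= f + j * l + k * binz l) ->
  th a e i m * th b f j k =
  \sum_(r < p) gsum (fun q => a ^ (h (r, q)).1 * b ^ (h (r, q)).2)
       (fun q => (e + i * (h (r, q)).1 + m * binz (h (r, q)).1) + (f + j * (h (r, q)).2 + k * binz (h (r, q)).2)).
Proof.
move=> bh m0 k0 h1 h2; rewrite th_mulE// (gsum_split _ bh)//.
by apply: (@properD _ _ (fun l => e + i * l + m * binz l) (fun l => f + j * l + k * binz l)) => //; apply: proper_th.
Qed.

Lemma th_mulZ_split x p (h : 'I_p * (int * int) -> int * int) a e i m b f j k :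
  bijective h -> 0 < m -> 0 < k ->
  (forall l, 0 <= e + i * l + m * binz l) -> (forall l, 0 <= f + j * l + k * binz l) ->
  serC x * (th a e i m * th b f j k) =
  \sum_(r < p) gsum (fun q => x * (a ^ (h (r, q)).1 * b ^ (h (r, q)).2))
       (fun q => (e + i * (h (r, q)).1 + m * binz (h (r, q)).1) + (f + j * (h (r, q)).2 + k * binz (h (r, q)).2)).
Proof.
move=> bh m0 k0 h1 h2; rewrite th_mulZE// (gsum_split _ bh)//.
by apply: (@properD _ _ (fun l => e + i * l + m * binz l) (fun l => f + j * l + k * binz l)) => //; apply: proper_th.
Qed.

Lemma sign_exprz (j : int) c : (- c) ^ j = (-1) ^ j * c ^ j.
Proof. by rewrite -[- c]mulN1r expfzMl. Qed.

Lemma signz_add2 (j k : int) : (-1) ^ (j + 2 * k) = (-1) ^ j :> R.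
Proof. by rewrite expfzDr ?oppr_eq0 ?oner_eq0// -exprz_exp (_ : (-1) ^ 2 = 1 :> R) ?exp1rz ?mulr1// -exprnP sqrrN expr1n. Qed.

Lemma exprz_sqr c (k : int) : (c ^+ 2) ^ k = c ^ (2 * k).
Proof. by rewrite exprnP exprz_exp. Qed.

(** Class r collects the pairs whose coordinates differ by an integer congruent to r mod 2; the
    rotation leaves binz x + binz y without cross term and doubles the base. *)
Definition parity_split (x : 'I_2 * (int * int)) : int * int :=
  (x.2.1 + x.2.2, x.2.1 - x.2.2 + (x.1 : nat)%:Z).

Lemma parity_split_bij : bijective parity_split.
Proof.
exists (fun y => (inord `|((y.1 - y.2) %% 2)%Z|,
   (y.1 - ((y.1 - y.2 + 1) %/ 2)%Z, ((y.1 - y.2 + 1) %/ 2)%Z))).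
  move=> [r [k l]]; rewrite /parity_split /=; have lr := ltn_ord r.
  have E : `|((k + l - (k - l + (r : nat)%:Z)) %% 2)%Z|%N = r by lia.
  congr (_, (_, _)); first by rewrite E inord_val.
    by lia.
  by lia.
move=> [k l]; rewrite /parity_split /= inordK; last by lia.
by congr (_, _); lia.
Qed.

(** After the rotation a carries only the sum of the two indices and b only their difference, so
    each class factors into a series in a times a series in b. The odd class has sign -1 and gives
    the subtracted term. *)
Lemma th_mul_parity a b (i j m : int) : a != 0 -> b != 0 -> 0 < m -> 0 <= j <= i -> i + j <= m ->
  th (- (a * b)) 0 (i + j) m * th (- (a / b)) 0 (i - j) m =
  th (a ^+ 2) 0 (2 * i) (2 * m) * th (b ^+ 2) 0 (2 * j + m) (2 * m)
  - serC (a / b) * (th (a ^+ 2) (i - j) (2 * i + m) (2 * m) * th (b ^+ 2) 0 (2 * j) (2 * m)).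
Proof.
move=> a0 b0 m0 ji ijm.
rewrite (th_mul_split _ _ parity_split_bij)//; try by move=> l; rewrite add0r; apply: th_exp_ge0; lia.
rewrite big_ord_recl big_ord1 -[- (serC _ * _)]mulNr -[- serC _]rmorphN th_mulZE ?[X in _ = X + _]th_mulE; try by lia.
all: try by move=> l; rewrite add0r; apply: th_exp_ge0; lia.
all: try by move=> l; have := @th_exp_ge0' (i - j) (2 * i + m) (2 * m) l;
  have := @th_exp_ge0 (2 * i + m) (2 * m) l; have [] := lerP (2 * i) m; lia.
have pw k l : (a * b) ^ k * (a / b) ^ l = a ^ (k + l) * b ^ (k - l).
  by rewrite !expfzMl !exprz_inv !expfzDr// mulrACA.
have sgn k l : (- (a * b)) ^ k * (- (a / b)) ^ l = (-1) ^ (k + l) * (a ^ (k + l) * b ^ (k - l)).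
  by rewrite 2!(sign_exprz _ (_ * _)) mulrACA pw -expfzDr// oppr_eq0 oner_eq0.
congr (_ + _); apply: eq_gsum => -[k l] /=.
- rewrite sgn addr0 (_ : k + l + (k - l) = 0 + 2 * k); last by ring.
  rewrite signz_add2 expr0z mul1r add0r (_ : k + l - (k - l) = 2 * l); last by ring.
  by rewrite !exprz_sqr.
- binz_lia m.
- rewrite sgn (_ : k + l + (k - l + 1%N%:Z) = 1 + 2 * k); last by ring.
  rewrite signz_add2 expr1z (_ : k + l - (k - l + 1%N%:Z) = 2 * l - 1); last by ring.
  by rewrite !expfzDr// !exprz_sqr expr1z exprN1; ring.
- binz_lia m.
Qed.

Lemma exprz_cube c (k : int) : (c ^+ 3) ^ k = c ^ (3 * k).
Proof. by rewrite exprnP exprz_exp. Qed.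

(** For indices (n, k) the form n^2 + 2 k^2 is diagonal along (1, 1) and (-2, 1), and n + 2 k is the
    exponent of a. Class r has n + 2 k = 3 t + r, so that l carries no a; in class 2 the sign of l
    is reversed to produce the same series in l as class 1. *)
Definition third_splitX (x : 'I_3 * (int * int)) : int * int :=
  match (x.1 : nat) with
  | 0%N => (x.2.2 - 2 * x.2.1, x.2.2 + x.2.1)
  | 1%N => (x.2.2 + 1 - 2 * x.2.1, x.2.2 + x.2.1)
  | _ => (x.2.2 + 2 * x.2.1, x.2.2 + 1 - x.2.1)
  end.

Lemma third_splitX_bij : bijective third_splitX.
Proof.
exists (fun y => let N := y.1 + 2 * y.2 in let t := (N %/ 3)%Z in let r := `|(N %% 3)%Z|%N in
  (inord r, (if r == 2%N then t + 1 - y.2 else y.2 - t, t))).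
  move=> [[[|[|[|r]]] //= lr] [l t]]; rewrite /third_splitX /=.
  - have -> : `|((t - 2 * l + 2 * (t + l)) %% 3)%Z|%N = 0%N by lia.
    by congr (_, (_, _)); [apply: val_inj; rewrite /= inordK|rewrite /=; lia|lia].
  - have -> : `|((t + 1 - 2 * l + 2 * (t + l)) %% 3)%Z|%N = 1%N by lia.
    by congr (_, (_, _)); [apply: val_inj; rewrite /= inordK|rewrite /=; lia|lia].
  - have -> : `|((t + 2 * l + 2 * (t + 1 - l)) %% 3)%Z|%N = 2%N by lia.
    by congr (_, (_, _)); [apply: val_inj; rewrite /= inordK|rewrite /=; lia|lia].
move=> [n k]; rewrite /third_splitX /=.
have : (`|((n + 2 * k) %% 3)%Z| < 3)%N by lia.
case E : `|((n + 2 * k) %% 3)%Z|%N => [|[|[|r]]] //= _; rewrite inordK//=; congr (_, _); lia.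
Qed.

(** As [third_splitX], but with classes given by n + 2 k + 1, because of the extra factor a in
    [th_mulY]. *)
Definition third_splitY (x : 'I_3 * (int * int)) : int * int :=
  match (x.1 : nat) with
  | 0%N => (x.2.2 - 1 - 2 * x.2.1, x.2.2 + x.2.1)
  | 1%N => (x.2.2 - 2 * x.2.1, x.2.2 + x.2.1)
  | _ => (x.2.2 + 1 + 2 * x.2.1, x.2.2 - x.2.1)
  end.

Lemma third_splitY_bij : bijective third_splitY.
Proof.
exists (fun y => let N := y.1 + 2 * y.2 + 1 in let t := (N %/ 3)%Z in let r := `|(N %% 3)%Z|%N in
  (inord r, (if r == 2%N then t - y.2 else y.2 - t, t))).
  move=> [[[|[|[|r]]] //= lr] [l t]]; rewrite /third_splitY /=.
  - have -> : `|((t - 1 - 2 * l + 2 * (t + l) + 1) %% 3)%Z|%N = 0%N by lia.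
    by congr (_, (_, _)); [apply: val_inj; rewrite /= inordK|rewrite /=; lia|lia].
  - have -> : `|((t - 2 * l + 2 * (t + l) + 1) %% 3)%Z|%N = 1%N by lia.
    by congr (_, (_, _)); [apply: val_inj; rewrite /= inordK|rewrite /=; lia|lia].
  - have -> : `|((t + 1 + 2 * l + 2 * (t - l) + 1) %% 3)%Z|%N = 2%N by lia.
    by congr (_, (_, _)); [apply: val_inj; rewrite /= inordK|rewrite /=; lia|lia].
move=> [n k]; rewrite /third_splitY /=.
have : (`|((n + 2 * k + 1) %% 3)%Z| < 3)%N by lia.
case E : `|((n + 2 * k + 1) %% 3)%Z|%N => [|[|[|r]]] //= _; rewrite inordK//=; congr (_, _); lia.
Qed.

(** The sums over l are theta constants independent of a and i; the sums over t are the series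
    called [thU] and [thV] below. *)
Lemma th_mulX a (i m : int) : a != 0 -> 0 < m -> 0 <= i <= m ->
  th (- a) 0 i m * th (a ^+ 2) 0 (2 * i) (2 * m) =
  th 1 0 (3 * m) (6 * m) * th (- a ^+ 3) 0 (3 * i) (3 * m)
  + th 1 0 m (6 * m) * (serC (a ^+ 2) * th (- a ^+ 3) (2 * i) (3 * i + 2 * m) (3 * m)
                        - serC a * th (- a ^+ 3) i (3 * i + m) (3 * m)).
Proof.
move=> a0 m0 im.
have X1 l : 0 <= 2 * i + (3 * i + 2 * m) * l + 3 * m * binz l.
  have := @th_exp_ge0' (2 * i) (3 * i + 2 * m) (3 * m) l; have := @th_exp_ge0 (3 * i + 2 * m) (3 * m) l.
  by have [] := lerP (3 * i) m; lia.
have X2 l : 0 <= i + (3 * i + m) * l + 3 * m * binz l.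
  have := @th_exp_ge0' i (3 * i + m) (3 * m) l; have := @th_exp_ge0 (3 * i + m) (3 * m) l.
  by have [] := lerP (3 * i) (2 * m); lia.
have X3 l : 0 <= 0 + 2 * i * l + 2 * m * binz l by rewrite add0r; apply: th_exp_ge0; lia.
have X4 l : 0 <= 0 + 3 * m * l + 6 * m * binz l by rewrite add0r; apply: th_exp_ge0; lia.
have X5 l : 0 <= 0 + i * l + m * binz l by rewrite add0r; apply: th_exp_ge0; lia.
have X6 l : 0 <= 0 + 3 * i * l + 3 * m * binz l by rewrite add0r; apply: th_exp_ge0; lia.
have X7 l : 0 <= 0 + m * l + 6 * m * binz l by rewrite add0r; apply: th_exp_ge0; lia.
rewrite (th_mul_split _ _ third_splitX_bij)//; last by lia.
rewrite 2!big_ord_recl big_ord1 [X in _ = X + _]th_mulE//; try by lia.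
rewrite mulrBr !(mulrCA _ (serC _)) -[- (serC _ * _)]mulNr -[- serC _]rmorphN !th_mulZE//; try by lia.
rewrite [X in _ = _ + X]addrC.
have sgn (n k : int) : (- a) ^ n * (a ^+ 2) ^ k = (-1) ^ n * a ^ (n + 2 * k).
  by rewrite sign_exprz exprz_sqr expfzDr// mulrA.
have sgn3 (t : int) : (- a ^+ 3) ^ t = (-1) ^ t * a ^ (3 * t) by rewrite sign_exprz exprz_cube.
congr (_ + (_ + _)); apply: eq_gsum => -[l t] /=; try binz_lia m; rewrite sgn sgn3 exp1rz mul1r.
- rewrite (_ : t - 2 * l = t + 2 * (- l)) ?signz_add2; last by ring.
  by congr (_ * a ^ _); ring.
- rewrite (_ : t + 1 - 2 * l = t + 1 + 2 * (- l)) ?signz_add2; last by ring.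
  rewrite (_ : t + 1 + 2 * (- l) + 2 * (t + l) = 1 + 3 * t); last by ring.
  by rewrite !expfzDr ?oppr_eq0 ?oner_eq0// expr1z; ring.
- rewrite signz_add2 (_ : t + 2 * l + 2 * (t + 1 - l) = 2%N%:Z + 3 * t); last by ring.
  by rewrite !expfzDr// -[a ^ 2%N%:Z]exprnP; ring.
Qed.

Lemma th_mulY a (i m : int) : a != 0 -> 0 < m -> 0 <= i -> 2 * i <= m ->
  serC a * (th (- a) 0 i m * th (a ^+ 2) i (2 * i + m) (2 * m)) =
  - (th 1 m (6 * m) (6 * m) * th (- a ^+ 3) 0 (3 * i) (3 * m))
  - th 1 0 (4 * m) (6 * m) * (serC (a ^+ 2) * th (- a ^+ 3) (2 * i) (3 * i + 2 * m) (3 * m)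
                        - serC a * th (- a ^+ 3) i (3 * i + m) (3 * m)).
Proof.
move=> a0 m0 i0 im.
have X1 l : 0 <= 2 * i + (3 * i + 2 * m) * l + 3 * m * binz l.
  have := @th_exp_ge0' (2 * i) (3 * i + 2 * m) (3 * m) l; have := @th_exp_ge0 (3 * i + 2 * m) (3 * m) l.
  by have [] := lerP (3 * i) m; lia.
have X2 l : 0 <= i + (3 * i + m) * l + 3 * m * binz l.
  have := @th_exp_ge0' i (3 * i + m) (3 * m) l; have := @th_exp_ge0 (3 * i + m) (3 * m) l.
  by have [] := lerP (3 * i) (2 * m); lia.
have X3 l : 0 <= i + (2 * i + m) * l + 2 * m * binz l.
  by rewrite -addrA; apply: addr_ge0 => //; apply: th_exp_ge0; lia.
have X4 l : 0 <= m + 6 * m * l + 6 * m * binz l by apply: th_exp_ge0'; lia.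
have X5 l : 0 <= 0 + i * l + m * binz l by rewrite add0r; apply: th_exp_ge0; lia.
have X6 l : 0 <= 0 + 3 * i * l + 3 * m * binz l by rewrite add0r; apply: th_exp_ge0; lia.
have X7 l : 0 <= 0 + 4 * m * l + 6 * m * binz l by rewrite add0r; apply: th_exp_ge0; lia.
rewrite (th_mulZ_split _ _ _ third_splitY_bij)//; last by lia.
rewrite 2!big_ord_recl big_ord1 mulrBr opprB !(mulrCA _ (serC _)) -[- (serC _ * _)]mulNr -[- serC _]rmorphN.
rewrite -[- (th _ _ _ _ * _)]mulN1r -[- 1](rmorphN1 (serC (R := R))) !th_mulZE//; try by lia.
have sgn (n k : int) : a * ((- a) ^ n * (a ^+ 2) ^ k) = (-1) ^ n * a ^ (1 + n + 2 * k).
  by rewrite sign_exprz exprz_sqr !expfzDr// expr1z; ring.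
have sgn3 (t : int) : (- a ^+ 3) ^ t = (-1) ^ t * a ^ (3 * t) by rewrite sign_exprz exprz_cube.
congr (_ + (_ + _)); apply: eq_gsum => -[l t] /=; try binz_lia m; rewrite sgn sgn3 exp1rz mul1r.
- rewrite (_ : t - 1 - 2 * l = 1 + t + 2 * (- l - 1)) ?signz_add2; last by ring.
  rewrite (_ : 1 + (1 + t + 2 * (- l - 1)) + 2 * (t + l) = 3 * t); last by ring.
  by rewrite !expfzDr ?oppr_eq0 ?oner_eq0// expr1z; ring.
- rewrite (_ : t - 2 * l = t + 2 * (- l)) ?signz_add2; last by ring.
  rewrite (_ : 1 + (t + 2 * (- l)) + 2 * (t + l) = 1 + 3 * t); last by ring.
  by rewrite !expfzDr// expr1z; ring.
- rewrite signz_add2 (_ : 1 + (t + 1 + 2 * l) + 2 * (t - l) = 2%N%:Z + 3 * t); last by ring.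
  by rewrite !expfzDr ?oppr_eq0 ?oner_eq0// -[a ^ 2%N%:Z]exprnP expr1z; ring.
Qed.
End ThetaTheory.

(** * Winquist's identity *)

Lemma poch_split (R : comNzRingType) (c : R) (p a m : nat) : (0 < p)%N -> (0 < m)%N ->
  poch c a m = \prod_(r < p) poch c (a + m * r) (p * m).
Proof.
move=> p0 m0; rewrite -(iprod_bigprod (I := 'I_p) _ (F := fun r k => fac c (a + m * r + p * m * k))); last first.
  by move=> r; apply: adm_fac; rewrite muln_gt0 p0.
have aF : admissible (fun k => \prod_(r < p) fac c (a + m * r + p * m * k)).
  move=> k; apply: (@eqmod_trans _ _ (\prod_(r < p) 1)); last by rewrite big1.
  apply: eqmod_prod => r _; apply: eqmod_fac; apply: leq_trans (leq_addl _ _).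
  by rewrite leq_pmull// muln_gt0 p0.
apply: iprod_eqP => // N.
have -> : \prod_(k < N) \prod_(r < p) fac c (a + m * r + p * m * k) = \prod_(j < p * N) fac c (a + m * j).
  elim: N => [|N IH]; first by rewrite muln0 !big_ord0.
  rewrite big_ord_recr IH mulnSr big_split_ord /=; congr (_ * _); apply: eq_bigr => r _.
  by congr fac; ring.
by apply: iprod_eqmod; [apply: adm_fac|nia].
Qed.

Section Winquist.
Variable R : fieldType.
Implicit Types a b : R.

(* With [a q^i] for the argument and [q^m] for the base, [thU] and [thV] span the
   antisymmetric theta series of degree 3. *)
Definition thU a (i m : nat) := th (- a ^+ 3) 0 (3 * i)%N (3 * m)%N.
Definition thV a (i m : nat) : ser R :=
  serC (a ^+ 2) * th (- a ^+ 3) (2 * i)%N (3 * i + 2 * m)%N (3 * m)%N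
  - serC a * th (- a ^+ 3) i (3 * i + m)%N (3 * m)%N.

(* The 2 x 2 determinant is the right-hand side of [th_mul_parity] for the base
   [q^(3m)] and arguments [q^(2m)] and [1]. *)
Lemma theta_det (m : nat) : (0 < m)%N ->
  th 1 0 (3 * m)%N (6 * m)%N * th 1 0 (4 * m)%N (6 * m)%N
  - th 1 m (6 * m)%N (6 * m)%N * th 1 0 m (6 * m)%N = poch (1 : R) m m ^+ 2.
Proof.
move=> m0; have J : th (- 1) 0 (2 * m)%N (3 * m)%N = poch (1 : R) m m.
  rewrite jtp ?oner_neq0//; try by lia.
  have -> : (3 * m - 2 * m = m)%N by lia.
  rewrite (poch_split (1 : R) m (p := 3) (m := m))// !big_ord_recl big_ord0 invr1 mulr1 /= /bump /=.
  have [-> -> ->] : [/\ m + m * 0 = m, m + m * (1 + 0) = 2 * m & m + m * (1 + (1 + 0)) = 3 * m]%N by split; lia.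
  by ring.
have := @th_mul_parity R 1 1 (2 * m)%N 0 (3 * m)%N.
rewrite mulr1 divr1 !expr1n rmorph1 mul1r addr0 J oner_eq0 => /(_ isT isT).
move=> /(_ ltac:(lia) ltac:(lia) ltac:(lia)) E.
have e6 : 2 * (3 * m)%N%:Z = (6 * m)%N by lia.
have e4 : 2 * (2 * m)%N%:Z = (4 * m)%N by lia.
have e3 : 2 * 0 + (3 * m)%N%:Z = (3 * m)%N by lia.
move: E; rewrite e6 e4 e3 mulr0 => E.
rewrite expr2 E [X in _ = X - _]mulrC; congr (_ - _).
rewrite [in RHS](@th_shift _ (-1)) ?oner_eq0//; last by lia.
rewrite exp1rz rmorph1 mul1r [X in _ = _ * X]th_refl invr1 subr0.
have e1 : (2 * m)%N%:Z + ((4 * m)%N%:Z + (3 * m)%N%:Z) * -1 + (6 * m)%N%:Z * binz (-1) = m.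
  by rewrite (_ : binz (-1) = 1)//; lia.
have e2 : (4 * m)%N%:Z + (3 * m)%N%:Z + (6 * m)%N%:Z * -1 = m by lia.
rewrite e1 e2.
rewrite -[th 1 m (6 * m)%N _](@th_qX0 _ m); last by lia.
rewrite -[th 1 m m _](@th_qX0 _ m); last by lia.
by ring.
Qed.

(** By [th_mul_parity] the left side is a 2 x 2 determinant of products Ta Xa, Ta Ya, Tb Xb, Tb Yb.
    [th_mulX] and [th_mulY] express these through [thU] and [thV] by one matrix, the same for a and
    b; determinants multiply, and that of the matrix is given by [theta_det]. *)
Theorem winquist a b (i j m : nat) : a != 0 -> b != 0 -> (0 < m)%N -> (j <= i)%N -> (2 * i <= m)%N ->
  serC b * qX ^+ j * (th (- a) 0 i m * th (- b) 0 j m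
     * (th (- (a * b)) 0 (i + j)%N m * th (- (a / b)) 0 (i - j)%N m))
  = poch 1 m m ^+ 2 * (thV a i m * thU b j m - thU a i m * thV b j m).
Proof.
move=> a0 b0 m0 ji im.
have m0' : 0 < m%:Z by lia.
have /(_ ltac:(lia) ltac:(lia)) H1 := th_mul_parity a0 b0 m0' (i := i) (j := j).
have /(_ ltac:(lia)) H2 := th_mulX a0 m0' (i := i).
have /(_ ltac:(lia)) H2' := th_mulX b0 m0' (i := j).
have /(_ ltac:(lia) ltac:(lia)) H3 := th_mulY a0 m0' (i := i).
have /(_ ltac:(lia) ltac:(lia)) H3' := th_mulY b0 m0' (i := j).
have q1 : qX ^+ i = qX ^+ j * qX ^+ (i - j) :> ser R by rewrite -exprD subnKC.
have s1 : serC a = serC b * serC (a / b) by rewrite -rmorphM mulrCA divff// mulr1.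
rewrite -(@th_qX0 _ i) in H3; last by lia.
rewrite -(@th_qX0 _ j) in H3'; last by lia.
rewrite (_ : i%:Z - j%:Z = (i - j)%N) -?(@th_qX0 _ (i - j)%N) in H1; try by lia.
rewrite -theta_det// /thU /thV PoszD !PoszM.
rewrite -[6%N%:Z]/(6 : int) -[3%N%:Z]/(3 : int) -[2%N%:Z]/(2 : int) -[4%N%:Z]/(4 : int).
have -> : (3 * i + 2 * m)%N%:Z = 3 * i%:Z + 2 * m%:Z by lia.
have -> : (3 * j + 2 * m)%N%:Z = 3 * j%:Z + 2 * m%:Z by lia.
have -> : (3 * i + m)%N%:Z = 3 * i%:Z + m%:Z by lia.
have -> : (3 * j + m)%N%:Z = 3 * j%:Z + m%:Z by lia.
rewrite {}H1.
set Va := serC (a ^+ 2) * _ - _ in H2 H3 *; set Vb := serC (b ^+ 2) * _ - _ in H2' H3' *.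
move: Va Vb H2 H2' H3 H3' => Va Vb.
move=> H2 H2' H3 H3'.
set Ta := th (- a) 0 i m in H2 H3 *; set Tb := th (- b) 0 j m in H2' H3' *.
set Xa := th (a ^+ 2) 0 (2 * _) _ in H2 *; set Xb := th (b ^+ 2) 0 (2 * _) _ in H2' *.
set Ya := th (a ^+ 2) 0 (2 * _ + _) _ in H3 *; set Yb := th (b ^+ 2) 0 (2 * _ + _) _ in H3' *.
transitivity ((Ta * Xa) * (serC b * (Tb * (qX ^+ j * Yb)))
  - (serC a * (Ta * (qX ^+ i * Ya))) * (Tb * Xb)).
  by rewrite s1 q1; move: (qX ^+ j) (qX ^+ (i - j)) => qj qij; ring.
by rewrite H2 H2' H3 H3'; ring.
Qed.
End Winquist.

(** * The generating function of the crank *)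

Section Cauchy.
Variable R : comNzRingType.
Implicit Types a c : R.

(** The quotient (a q; q)_j / (q; q)_j; [cauchy_sum] truncates the q-binomial series at the argument
    c q^e. *)
Definition cauchy_coef a j : ser R := \prod_(i < j) (fac a i.+1 * geo 1 i.+1).
Definition cauchy_sum N a c e : ser R := \sum_(j < N) cauchy_coef a j * (serC (c ^+ j) * qX ^+ (e * j)).

Lemma cauchy_coefS a j : fac 1 j.+1 * cauchy_coef a j.+1 = fac a j.+1 * cauchy_coef a j.
Proof.
rewrite /cauchy_coef big_ord_recr /= mulrCA (mulrC (fac a _)) (mulrA (fac 1 _)) fac_geo//.
by rewrite mul1r mulrC.
Qed.

(** The functional equation (1 - t) f(t) = (1 - A t) f(q t) of the q-binomial series, at t = c q^e
    and A = a q. Truncation leaves a single defect term, of order q^(e N), which is computed exactly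
    in [E]. *)
Lemma cauchy_step N a c e : (0 < e)%N ->
  eqmod N (fac c e * cauchy_sum N a c e) (fac (a * c) e.+1 * cauchy_sum N a c e.+1).
Proof.
move=> e0.
suff E : fac c e * cauchy_sum N a c e - fac (a * c) e.+1 * cauchy_sum N a c e.+1
    = - (qX ^+ (e * N) * (serC (c ^+ N) * (fac 1 N * cauchy_coef a N))).
  rewrite -[X in eqmod _ X _](subrK (fac (a * c) e.+1 * cauchy_sum N a c e.+1)) E.
  rewrite -[X in eqmod _ _ X]add0r; apply: eqmodD => //.
  by rewrite -[X in eqmod _ _ X]oppr0; apply: eqmodN; apply: eqmod_qXn0; nia.
elim: N => [|N IH].
  by rewrite /cauchy_sum !big_ord0 !mulr0 /fac rmorph1 muln0 !expr0 mulr1 !subrr mul0r !mulr0 oppr0.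
rewrite /cauchy_sum !big_ord_recr /= -!/(cauchy_sum _ _ _ _).
rewrite !mulrDr opprD addrACA {}IH cauchy_coefS.
have X1 k : qX ^+ (e.+1 * k) = qX ^+ (e * k) * qX ^+ k :> ser R by rewrite -exprD mulSn addnC.
have X2 : qX ^+ (e * N.+1) = qX ^+ (e * N) * qX ^+ e :> ser R by rewrite -exprD mulnS addnC.
rewrite X1 X2 /fac rmorphM (exprS c) !rmorphM rmorph1 (exprS _ N) (exprS _ e).
by ring.
Qed.

Lemma cauchy_sum1 N a c : eqmod N (cauchy_sum N a c N.+1) 1.
Proof.
case: N => // N; rewrite /cauchy_sum big_ord_recl /cauchy_coef big_ord0 muln0 mul1r rmorph1 mul1r.
rewrite -[X in eqmod _ _ X]addr0; apply: eqmodD => //.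
apply: (@eqmod_trans _ _ (\sum_(i < N) 0)); last by rewrite big1.
by apply: eqmod_sum => i _; rewrite mulrA mulrC; apply: eqmod_qXn0; rewrite /= /bump; nia.
Qed.

(* The q-binomial theorem at A = a q and t = c q. *)
Lemma cauchy N a c : eqmod N (cauchy_sum N a c 1) (poch (a * c) 2 1 * ipoch c 1 1).
Proof.
have E : poch c 1 1 * ipoch c 1 1 = 1 by apply: poch_ipoch.
apply: (eqmod_cancel E); rewrite mulrCA E mulr1.
have H K : eqmod N (\prod_(k < K) fac c (1 + 1 * k) * cauchy_sum N a c 1)
                   (\prod_(k < K) fac (a * c) (2 + 1 * k) * cauchy_sum N a c K.+1).
  elim: K => [|K IH]; first by rewrite !big_ord0.
  rewrite !big_ord_recr /= mulrAC; apply: eqmod_trans (eqmodMr _ IH) _.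
  rewrite -!mulrA; apply: eqmodMl; rewrite mulrC !mul1n add1n; exact: cauchy_step.
apply: eqmod_trans (eqmodMr _ (iprod_eqmod (adm_fac _ _ _) (leqnn N))) _ => //.
apply: eqmod_trans (H N) _; rewrite -[X in eqmod _ _ X]mulr1; apply: eqmodM; last exact: cauchy_sum1.
by apply: eqmod_sym; apply: iprod_eqmod => //; apply: adm_fac.
Qed.

End Cauchy.

(** * The crank through multiplicative weights *)

Section Crank.
Variable R : fieldType.
Variable z : R.
Hypothesis z0 : z != 0.

Lemma ptn_gf n (v : nat -> nat -> R) :
  \sum_(f : ptn n | is_partition f) \prod_(i < n) v i (f i) =
  (\prod_(i < n) \sum_(k < n.+1) serC (v i k) * qX ^+ (i.+1 * k)) n.
Proof.
rewrite (bigA_distr_bigA (fun (i : 'I_n) (k : 'I_n.+1) => serC (v i k) * qX ^+ (i.+1 * k))).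
rewrite coef_ser_sum big_mkcond; apply: eq_bigr => f _.
rewrite big_split -rmorph_prod prodrXr coef_serCM coef_qXn /is_partition eq_sym.
by case: eqP => _; rewrite ?mulr1 ?mulr0.
Qed.

(* weight of multiplicity [k] of the part [i.+1], in partitions with [j > 0] ones *)
Definition ones_weight j (i k : nat) : R :=
  if i == 0%N then (k == j)%:R * z ^- j else if (j < i.+1)%N then z ^+ k else 1.
(* the same for partitions without ones and with largest part [l] *)
Definition largest_weight l (i k : nat) : R :=
  if i == 0%N then (k == 0%N)%:R else
  if i.+1 == l then (0 < k)%N%:R * z ^+ l else
  if (l < i.+1)%N then (k == 0%N)%:R else 1.

Lemma omegaE n (f : ptn n.+1) : omega f = f ord0.
Proof. by rewrite /omega (big_pred1 ord0)// => -[[]]. Qed.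

Lemma lambda_attained n (f : ptn n) : (0 < n)%N -> is_partition f ->
  exists2 i : 'I_n, f i != 0 :> nat & lambda f = i.+1.
Proof.
move=> n0 pf; have [i0 fi0] : exists i0, f i0 != 0 :> nat.
  apply/existsP; apply: contraLR pf; rewrite negb_exists => /forallP h.
  rewrite /is_partition big1 -?lt0n// ?neq_ltn ?n0// => i _.
  by have := h i; rewrite negbK => /eqP ->; rewrite muln0.
rewrite /lambda (@bigop.bigmax_eq_arg _ i0 (fun i => f i != 0%N :> nat) _ fi0); case: arg_maxnP => // i fi _.
by exists i.
Qed.

Lemma lambda_max n (f : ptn n) (i : 'I_n) : (f i != 0 :> nat) -> (i.+1 <= lambda f)%N.
Proof. by move=> fi; apply: (@bigop.leq_bigmax_cond _ (fun i : 'I_n => f i != 0 :> nat) (fun i => i.+1)). Qed.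

(** Exactly one term survives: l = [lambda f] when f has no ones, j = [omega f] otherwise. This
    replaces z^crank by weights that are products over the parts. The index l starts at 2 because a
    partition of a positive number without ones has a part at least 2. *)
Lemma crank_weights n (f : ptn n.+1) : is_partition f ->
  z ^ crank f = \sum_(2 <= l < n.+2) \prod_(i < n.+1) largest_weight l i (f i)
              + \sum_(1 <= j < n.+2) \prod_(i < n.+1) ones_weight j i (f i).
Proof.
move=> pf; rewrite /crank; case: eqVneq => w0.
  have f0 : f ord0 = 0 :> nat by rewrite -omegaE.
  rewrite [X in _ + X]big_nat [X in _ + X]big1 ?addr0; last first.
    by move=> j /andP[j0 _]; rewrite big_ord_recl /ones_weight /= f0 eq_sym -leqn0 leqNgt j0 !mul0r.
  have [i fi li] := lambda_attained (ltn0Sn n) pf.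
  have i0 : (0 < i)%N.
    by rewrite lt0n; apply: contra_neq fi => i0; rewrite (_ : i = ord0) ?f0//; apply: val_inj.
  rewrite (bigD1_seq i.+1) ?iota_uniq//=; last by rewrite mem_index_iota; have := ltn_ord i; lia.
  rewrite [X in _ + X]big1_seq ?addr0; last first.
    move=> l /andP[il]; rewrite mem_index_iota => /andP[l2 ln].
    have [lil|] := ltnP l i.+1.
      rewrite (bigD1 i)//= /largest_weight ifF; last by lia.
      by rewrite eq_sym (negPf il) lil (negPf fi) mul0r.
    rewrite leq_eqVlt eq_sym (negPf il) /= => il'.
    have ln' : (l.-1 < n.+1)%N by lia.
    rewrite (bigD1 (Ordinal ln'))//= /largest_weight ifF; last by lia.
    rewrite prednK ?eqxx; last by lia.
    rewrite lt0n (_ : (f _ != 0%N :> nat) = false) ?mul0r//; apply/negbTE/negP => fl; have := lambda_max fl.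
    by rewrite li /=; lia.
  rewrite li (bigD1 i)//= [X in _ * X]big1 => [|k ki]; rewrite /largest_weight.
    by rewrite mulr1 ifF ?eqxx; [rewrite lt0n fi mul1r|lia].
  have [k0|_] := eqVneq (k : nat) 0%N; first by rewrite (_ : k = ord0) ?f0//; apply: val_inj.
  rewrite ifF; last by apply: contra_neqF ki => /eqP[ki]; apply: val_inj.
  case: ltnP => // ik; case: eqP => // /eqP fk; have := lambda_max fk; lia.
have f0 : f ord0 = omega f :> nat by rewrite omegaE.
rewrite [X in _ = X + _]big_nat [X in _ = X + _]big1 ?add0r; last first.
  by move=> j /andP[j0 _]; rewrite big_ord_recl /largest_weight /= f0 (negPf w0) mul0r.
have wn : (omega f < n.+2)%N by rewrite -f0.
rewrite (bigD1_seq (omega f)) ?iota_uniq//=; last by rewrite mem_index_iota; lia.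
rewrite [X in _ = _ + X]big1_seq ?addr0; last first.
  by move=> j /andP[/negPf jw _]; rewrite big_ord_recl /ones_weight /= f0 eq_sym jw !mul0r.
rewrite big_ord_recl /ones_weight /= f0 eqxx mul1r expfzDr// mulrC -exprnN; congr (_ * _).
rewrite /mu big_mkcond big_ord_recl ifF; last by rewrite /=; lia.
rewrite /= add0n -exprnP -prodrXr; apply: eq_bigr => i _.
by case: ifP.
Qed.

End Crank.

Section CrankGF.
Variable R : fieldType.
Variable z : R.
Hypothesis z0 : z != 0.

Definition crank_series : ser R := poch 1 1 1 * ipoch z 1 1 * ipoch z^-1 1 1.

Lemma geo_trunc N (w : R) e : (0 < e)%N ->
  eqmod N (\sum_(k < N) serC (w ^+ k) * qX ^+ (e * k)) (geo w e).
Proof.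
move=> e0 n nN; rewrite coef_ser_sum /geo [RHS]/=.
under eq_bigr do rewrite coef_serCM coef_qXn.
case: ifP => [/dvdnP[k nk]|en].
  have kN : (k < N)%N by nia.
  rewrite (bigD1 (Ordinal kN))//= nk mulnK// mulnC eqxx mulr1 big1 ?addr0// => i /eqP ik.
  rewrite (_ : _ == _ = false) ?mulr0//; apply/negP => /eqP ke.
  by apply: ik; apply: val_inj; apply/eqP; rewrite /= -(eqn_pmul2l e0) -ke.
rewrite big1// => i _; rewrite (_ : n == _ = false) ?mulr0//; apply/negP => /eqP ni.
by rewrite ni dvdn_mulr in en.
Qed.

Lemma prod_ord_if (m n : nat) (F : nat -> ser R) : (m <= n)%N ->
  \prod_(i < n) (if (i < m)%N then F i else 1) = \prod_(i < m) F i.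
Proof. by move=> mn; rewrite -big_mkcond (big_ord_widen n F mn). Qed.

Lemma prod_ord_at (m n : nat) (x : ser R) : (m < n)%N ->
  \prod_(i < n) (if (i == m :> nat) then x else 1) = x.
Proof. by move=> mn; rewrite -big_mkcond (big_pred1 (Ordinal mn)). Qed.

(** The parts are 2, ..., l with l present, which gives (z q)^l / ((1 - q^2) ... (1 - q^l)) up to
    the exponent of q on z: the weight is z^l and the monomial q^l. The factor 1 - q completes the
    denominator to (q; q)_l. *)
Lemma largest_gf n l : (1 < l)%N -> (l < n.+2)%N ->
  eqmod n.+2 (\prod_(i < n.+1) \sum_(k < n.+2) serC (largest_weight z l i k) * qX ^+ (i.+1 * k))
    (fac 1 1 * (cauchy_coef 0 l * (serC (z ^+ l) * qX ^+ (1 * l)))).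
Proof.
move=> l1 ln.
pose H (i : nat) : ser R := (if i == 0%N then fac 1 1 else 1) *
  ((if i == l.-1 then serC (z ^+ l) * qX ^+ l else 1) * (if (i < l)%N then geo 1 i.+1 else 1)).
apply: (@eqmod_trans _ _ (\prod_(i < n.+1) H i)); last first.
  rewrite !big_split /= (prod_ord_at _ (ltn0Sn n)) prod_ord_at; last by lia.
  rewrite (prod_ord_if (fun i => geo 1 i.+1)); last by lia.
  rewrite mul1n [X in _ * X]mulrC /cauchy_coef.
  rewrite [\prod_(i < l) (_ * _)](eq_bigr (fun i : 'I_l => geo (1 : R) i.+1))// => i _.
  by rewrite /fac rmorph0 mul0r subr0 mul1r.
apply: eqmod_prod => i _; have lin := ltn_ord i; rewrite /largest_weight /H.
have one : eqmod n.+2 (\sum_(k < n.+2) serC ((k : nat) == 0%N)%:R * qX ^+ (i.+1 * k)) (1 : ser R).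
  rewrite big_ord_recl rmorph1 mul1r muln0 expr0 big1 ?addr0// => k _.
  by rewrite rmorph0 mul0r.
case: ifPn => i0.
  rewrite ifF; last by lia.
  rewrite ifT; last by lia.
  by move: one; rewrite (eqP i0) mul1r fac_geo.
rewrite mul1r; have [il|il] := eqVneq i.+1 l.
  rewrite [in X in eqmod _ _ X]ifT; last by lia.
  rewrite [in X in eqmod _ _ X]ifT; last by lia.
  have -> : serC (z ^+ l) * qX ^+ l * geo 1 i.+1 = serC (z ^+ l) * (geo 1 l - 1) :> ser R.
    rewrite -mulrA il; congr (_ * _); have := @fac_geo R 1 l ltac:(lia).
    rewrite /fac rmorph1 mul1r mulrBl mul1r => gE.
    by rewrite -[X in _ = _ - X]gE; ring.
  rewrite il.
  apply: (@eqmod_trans _ _ (serC (z ^+ l) * (\sum_(k < n.+2) serC (1 ^+ k) * qX ^+ (l * k) - 1))); last first.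
    by apply: eqmodMl; apply: eqmodD => //; apply: geo_trunc; lia.
  rewrite big_ord_recl /= mul0r rmorph0 mul0r add0r [X in _ * (X - 1)]big_ord_recl /=.
  rewrite [serC (1 ^+ 0)]rmorph1 muln0 expr0 mul1r addrAC subrr add0r.
  rewrite mulr_sumr; apply: eqmod_sum => k _; rewrite expr1n [serC 1]rmorph1 !mul1r.
  exact: eqmod_refl.
rewrite [in X in eqmod _ _ X]ifF ?mul1r; last by lia.
have [li|li] := ltnP l i.+1; first exact: one.
have := @geo_trunc n.+2 1 i.+1 isT.
by apply: eqmod_trans; apply: eqmod_sum => k _; rewrite expr1n; exact: eqmod_refl.
Qed.

(** The j ones give (q/z)^j, the parts above j carry z, and the parts 2, ..., j carry no weight. The
    ratio (z q; q)_j / (q; q)_j corrects the full product of 1 / (1 - z q^i) for the parts up to j,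
    and 1 - q cancels the part 1. *)
Lemma ones_gf n j : (0 < j)%N -> (j < n.+2)%N ->
  eqmod n.+2 (\prod_(i < n.+1) \sum_(k < n.+2) serC (ones_weight z j i k) * qX ^+ (i.+1 * k))
    (fac 1 1 * \prod_(i < n.+1) geo z i.+1 * (cauchy_coef z j * (serC (z^-1 ^+ j) * qX ^+ (1 * j)))).
Proof.
move=> j0 jn.
pose H (i : nat) : ser R := (if i == 0%N then fac 1 1 * (serC (z ^- j) * qX ^+ j) else 1) *
  (geo z i.+1 * (if (i < j)%N then fac z i.+1 * geo 1 i.+1 else 1)).
apply: (@eqmod_trans _ _ (\prod_(i < n.+1) H i)); last first.
  rewrite !big_split /= (prod_ord_at _ (ltn0Sn n)).
  rewrite (prod_ord_if (fun i => fac z i.+1 * geo 1 i.+1)); last by lia.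
  by rewrite mul1n -/(cauchy_coef _ _) exprVn => k kn; congr (coefs _ k); ring.
apply: eqmod_prod => i _; rewrite /ones_weight /H; case: ifPn => i0.
  rewrite (eqP i0) ifT; last by lia.
  rewrite (bigD1 (Ordinal jn))//= eqxx mul1r mul1n [X in _ + X]big1 ?addr0 => [|k kj]; last first.
    by rewrite (_ : (k : nat) == j = false) ?mul0r ?rmorph0 ?mul0r//; apply: contra_neqF kj => /eqP kj; apply: val_inj.
  have -> : fac 1 1 * (serC (z ^- j) * qX ^+ j) * (geo z 1 * (fac z 1 * geo 1 1))
    = (fac 1 1 * geo 1 1) * (fac z 1 * geo z 1) * (serC (z ^- j) * qX ^+ j) by ring.
  by rewrite !fac_geo// !mul1r.
rewrite mul1r; have [ji|ji] := ltnP j i.+1.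
  by rewrite mulr1; apply: geo_trunc.
rewrite mulrA (mulrC (geo z _)) fac_geo// mul1r.
have := @geo_trunc n.+2 1 i.+1 isT.
by apply: eqmod_trans; apply: eqmod_sum => k _; rewrite expr1n; exact: eqmod_refl.
Qed.

(** By [cauchy] with a = 0 the sum over l is (1 - q) (1 / (z q; q)_oo - 1) - z q; with a = z and c =
    1/z the sum over j is (1 - q) / (z q; q)_oo times (q^2; q)_oo / (q/z; q)_oo - 1. They add up to
    [crank_series] - (1 - q) - z q, and the correction ends at degree 1, whence n > 0. *)
Theorem crank_gf n : (0 < n)%N ->
  \sum_(f : ptn n.+1 | is_partition f) z ^ crank f = crank_series n.+1.
Proof.
move=> n0.
rewrite (eq_bigr _ (fun f pf => crank_weights z0 pf)) big_split /=.
rewrite exchange_big [X in _ + X]exchange_big /=.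
under eq_bigr do rewrite ptn_gf.
under [X in _ + X]eq_bigr do rewrite ptn_gf.
rewrite -!coef_ser_sum -coef_serD.
set G := \prod_(i < n.+1) geo z i.+1.
have E1 : eqmod n.+2 (\sum_(2 <= l < n.+2) \prod_(i < n.+1) \sum_(k < n.+2) serC (largest_weight z l i k) * qX ^+ (i.+1 * k))
   (fac 1 1 * (cauchy_sum n.+2 0 z 1 - 1) - serC z * qX).
  apply: (@eqmod_trans _ _ (\sum_(2 <= l < n.+2) (fac 1 1 * (cauchy_coef 0 l * (serC (z ^+ l) * qX ^+ (1 * l)))))).
    by rewrite !big_nat; apply: eqmod_sum => l /andP[l1 l2]; apply: largest_gf.
  rewrite -mulr_sumr /cauchy_sum -(big_mkord xpredT (fun l => cauchy_coef 0 l * (serC (z ^+ l) * qX ^+ (1 * l)))).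
  rewrite [in X in eqmod _ _ X]big_ltn// [in X in eqmod _ _ X]big_ltn//.
  have c0 : cauchy_coef 0 0 * (serC (z ^+ 0) * qX ^+ (1 * 0)) = 1.
    by rewrite /cauchy_coef big_ord0 muln0 !expr0 rmorph1 !mul1r.
  have c1 : cauchy_coef 0 1 * (serC (z ^+ 1) * qX ^+ (1 * 1)) = geo 1 1 * (serC z * qX).
    by rewrite /cauchy_coef big_ord1 /fac rmorph0 mul0r subr0 mul1r muln1 !expr1.
  rewrite c0 c1.
  have F := @fac_geo R 1 1 isT => k kn; congr (coefs _ k).
  set S := \sum_(_ <= _ < _) _.
  transitivity (fac 1 1 * S + (fac 1 1 * geo 1 1) * (serC z * qX) - serC z * qX); first by rewrite F; ring.
  by ring.
have E2 : eqmod n.+2 (\sum_(1 <= j < n.+2) \prod_(i < n.+1) \sum_(k < n.+2) serC (ones_weight z j i k) * qX ^+ (i.+1 * k))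
   (fac 1 1 * G * (cauchy_sum n.+2 z z^-1 1 - 1)).
  apply: (@eqmod_trans _ _ (\sum_(1 <= j < n.+2) (fac 1 1 * G * (cauchy_coef z j * (serC (z^-1 ^+ j) * qX ^+ (1 * j)))))).
    by rewrite !big_nat; apply: eqmod_sum => l /andP[l1 l2]; apply: ones_gf.
  rewrite -mulr_sumr /cauchy_sum big_ord_recl /cauchy_coef big_ord0 expr0 rmorph1 muln0 expr0 !mul1r addrAC subrr add0r.
  rewrite big_add1 big_mkord; exact: eqmod_refl.
have EG : eqmod n.+2 G (ipoch z 1 1).
  apply/eqmod_sym; apply: eqmod_trans (iprod_eqmod (adm_geo _ _ _) (leqnn _)) _ => //.
  rewrite big_ord_recr /= -[X in eqmod _ _ X]mulr1; apply: eqmodM; last by apply: eqmod_geo; lia.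
  by under eq_bigr do rewrite mul1n add1n.
have P0 : poch (0 : R) 2 1 = 1.
  by rewrite -[RHS]iprod1; apply: eq_iprod => k; rewrite /fac rmorph0 mul0r subr0.
have C1 := @cauchy R n.+2 0 z; have C2 := @cauchy R n.+2 z z^-1.
rewrite mul0r P0 mul1r in C1; rewrite divff// in C2.
have E : eqmod n.+2 (fac 1 1 * (cauchy_sum n.+2 0 z 1 - 1) - serC z * qX + fac 1 1 * G * (cauchy_sum n.+2 z z^-1 1 - 1))
   (crank_series - fac 1 1 - serC z * qX).
  rewrite /crank_series [poch 1 1 1]poch_rec//.
  apply: (@eqmod_trans _ _ (fac 1 1 * (ipoch z 1 1 - 1) - serC z * qX
     + fac 1 1 * ipoch z 1 1 * (poch 1 2 1 * ipoch z^-1 1 1 - 1))).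
    by repeat (apply: eqmodD => // || apply: eqmodM => //).
  by move=> k kn; congr (coefs _ k); ring.
rewrite (eqmodD E1 E2)// E// coef_serB coef_serB coef_fac coef_serCM.
by case: n n0 {E1 E2 G EG C1 C2 E} => // n _; rewrite /= !mulr0 !subr0.
Qed.

Lemma crank_series_mod2 : eqmod 2 crank_series (fac 1 1 * geo z 1 * geo z^-1 1).
Proof.
have P : eqmod 2 (poch (1 : R) 1 1) (fac 1 1).
  apply: eqmod_trans (iprod_eqmod (adm_fac _ _ _) (leqnn _)) _ => //.
  by rewrite big_ord_recl big_ord1 -[X in eqmod _ _ X]mulr1; apply: eqmodMl; apply: eqmod_fac.
have I (c : R) : eqmod 2 (ipoch c 1 1) (geo c 1).
  apply: eqmod_trans (iprod_eqmod (adm_geo _ _ _) (leqnn _)) _ => //.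
  by rewrite big_ord_recl big_ord1 -[X in eqmod _ _ X]mulr1; apply: eqmodMl; apply: eqmod_geo.
by apply: eqmodM => //; apply: eqmodM.
Qed.

Lemma coef_geo1 (c : R) n : geo c 1 n = c ^+ n.
Proof. by rewrite /= dvd1n divn1. Qed.

Lemma crank_series0 : crank_series 0%N = 1.
Proof. by rewrite crank_series_mod2// !(coef_serM, big_ord1) coef_fac !coef_geo1 mulr0 subr0 !mulr1. Qed.

Lemma crank_series1 : crank_series 1%N = z + z^-1 - 1.
Proof.
rewrite crank_series_mod2// coef_serM big_ord_recl big_ord1 !coef_serM big_ord1 big_ord_recl big_ord1.
rewrite !coef_fac !coef_geo1 /=; ring.
Qed.

End CrankGF.

(** * The substitution of a power of q *)

Section Subst.
Variable R : comNzRingType.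
Variable p : nat.
Hypothesis p0 : (0 < p)%N.
Implicit Types f g : ser R.

Definition qsubst f : ser R := Ser (fun n => if (p %| n)%N then f (n %/ p)%N else 0).

Lemma coef_qsubst f n : qsubst f n = if (p %| n)%N then f (n %/ p)%N else 0.
Proof. by []. Qed.

(** On truncations the substitution is composition with 'X^p, which respects products. *)
Lemma qsubstM f g : qsubst (f * g) = qsubst f * qsubst g.
Proof.
apply: serP => n.
have tr h i : (i < n.+1)%N -> (\poly_(i < n.+1) qsubst h i)`_i = ((\poly_(i < n.+1) h i) \Po 'X^p)`_i.
  move=> i_n; rewrite coef_poly i_n coef_comp_poly_Xn//= coef_poly; case: ifP => // pi.
  by rewrite ifT//; apply: leq_ltn_trans i_n; apply: leq_div.
rewrite [RHS](@ser_mul_poly _ n.+1)//.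
transitivity ((((\poly_(i < n.+1) f i) * (\poly_(i < n.+1) g i)) \Po 'X^p)`_n).
  rewrite coef_comp_poly_Xn// coef_qsubst; case: ifP => // pn.
  by apply: ser_mul_poly; rewrite ltnS leq_div.
rewrite comp_polyM !poly.coefM; apply: eq_bigr => i _; have li := ltn_ord i.
by rewrite -!tr//; lia.
Qed.

Lemma qsubst1 : qsubst 1 = 1.
Proof.
apply: serP => n; rewrite coef_qsubst !coef_ser1; case: ifP => [/dvdnP[k ->]|pn].
  by rewrite mulnK// muln_eq0 [p == _]eqn0Ngt p0 orbF.
by case: eqP pn => // ->; rewrite dvdn0.
Qed.

Lemma qsubstD f g : qsubst (f + g) = qsubst f + qsubst g.
Proof. by apply: serP => n; rewrite coef_serD !coef_qsubst; case: ifP; rewrite ?addr0. Qed.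
Lemma qsubstN f : qsubst (- f) = - qsubst f.
Proof. by apply: serP => n; rewrite coef_serN !coef_qsubst; case: ifP; rewrite ?oppr0. Qed.
Lemma qsubstC c : qsubst (serC c) = serC c.
Proof.
apply: serP => n; rewrite coef_qsubst /serC /=; case: ifP => [/dvdnP[k ->]|pn].
  by rewrite mulnK// muln_eq0 [p == _]eqn0Ngt p0 orbF.
by case: eqP pn => // ->; rewrite dvdn0.
Qed.
Lemma qsubst_qX k : qsubst (qX ^+ k) = qX ^+ (p * k).
Proof.
apply: serP => n; rewrite coef_qsubst !coef_qXn; case: ifP => [/dvdnP[m ->]|pn].
  by rewrite mulnK// mulnC eqn_pmul2l.
by rewrite (_ : n == _ = false)//; apply: contraFF pn => /eqP ->; apply: dvdn_mulr.
Qed.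

Lemma coef_qXn_qsubst r f n : (r < p)%N ->
  (qX ^+ r * qsubst f) n = if (n %% p == r)%N then f (n %/ p)%N else 0.
Proof.
move=> rp; rewrite coef_qXnM; case: ltnP => nr.
  by rewrite ifF// modn_small ?(ltn_trans nr)//; lia.
rewrite coef_qsubst; have -> : (p %| n - r = (n %% p == r))%N.
  by rewrite -eqn_mod_dvd// eq_sym (modn_small rp) eq_sym.
case: eqP => // E; rewrite {1}(divn_eq n p) E addnK mulnK//.
Qed.

Lemma qsubst_gsum (I : choiceType) (c : I -> R) e : qsubst (gsum c e) = gsum c (fun i => p%:Z * e i).
Proof.
apply: serP => n; rewrite coef_qsubst; case: ifP => [/dvdnP[k ->]|pn].
  rewrite mulnK// /gsum /=; apply: eq_fsbigr => i _; congr (if _ then _ else _).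
  by apply/eqP/eqP; nia.
rewrite /gsum /= fsbig1// => i _; rewrite ifF//; apply/eqP => ein.
by move/negP: pn; apply; apply/dvdnP; exists `|e i|%N; nia.
Qed.

Lemma qsubst_poch c a m : (0 < a)%N -> (0 < m)%N -> qsubst (poch c a m) = poch c (p * a) (p * m).
Proof.
move=> a0 m0; apply: iprod_eqP => [|N]; first by apply: adm_fac; nia.
have -> : \prod_(k < N) fac c (p * a + p * m * k) = qsubst (\prod_(k < N) fac c (a + m * k)).
  rewrite (big_morph qsubst qsubstM qsubst1); apply: eq_bigr => k _.
  rewrite /fac qsubstD qsubstN qsubstM qsubst1 qsubst_qX; congr (_ - _ * qX ^+ _); last by ring.
  by rewrite qsubstC.
move=> n nN; rewrite !coef_qsubst; case: ifP => // _.
by apply: iprod_eqmod (leqnn N) _ _; [apply: adm_fac|apply: leq_ltn_trans nN; apply: leq_div].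
Qed.

End Subst.

(** * Integer series read in a commutative ring *)

Section OfFps.
Variable R : comNzRingType.

Definition of_fps (f : fps) : ser R := Ser (fun n => (f n)%:~R).

Lemma of_fpsM f g : of_fps (fmul f g) = of_fps f * of_fps g.
Proof.
apply: serP => n; rewrite coef_serM /= /fmul rmorph_sum; apply: eq_bigr => i _.
by rewrite rmorphM.
Qed.
Lemma of_fps1 : of_fps fone = 1.
Proof. by apply: serP => n; rewrite coef_ser1 /= /fone; case: eqP. Qed.
Lemma of_fps_infprod F : of_fps (infprod F) = iprod (fun k => of_fps (F k)).
Proof.
apply: serP => n; rewrite /= /infprod.
by rewrite -(big_morph of_fps of_fpsM of_fps1).
Qed.
Lemma of_fps_one_minus_q e : of_fps (one_minus_q e) = fac 1 e.
Proof.
by apply: serP => n; rewrite coef_fac /= /one_minus_q rmorphB /= mul1r; case: eqP; case: eqP.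
Qed.
Lemma of_fps_geom e : of_fps (geom e) = geo 1 e.
Proof. by apply: serP => n; rewrite /= /geom; case: ifP; rewrite ?expr1n. Qed.
Lemma of_fps_qpoch a m : of_fps (qpoch a m) = poch 1 a m.
Proof. by rewrite of_fps_infprod; apply: eq_iprod => k; rewrite of_fps_one_minus_q. Qed.
Lemma of_fps_qpoch_inv a m : of_fps (qpoch_inv a m) = ipoch 1 a m.
Proof. by rewrite of_fps_infprod; apply: eq_iprod => k; rewrite of_fps_geom. Qed.
Lemma of_fps_qpow e : of_fps (fqpow e) = qX ^+ e.
Proof. by apply: serP => n; rewrite coef_qXn /= /fqpow; case: eqP. Qed.
Lemma of_fps_PinvK i : (0 < i < 11)%N -> of_fps (P i) * of_fps (Pinv i) = 1.
Proof.
move=> i11; rewrite /P /Pinv /Jam /Jam_inv !of_fpsM !of_fps_qpoch !of_fps_qpoch_inv.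
rewrite mulrACA (mulrACA (poch 1 (11 - i) 11)) !poch_ipoch ?mulr1//; lia.
Qed.
End OfFps.

(** * Dissection of theta series modulo 11 *)

Section Dissection.
Variable R : fieldType.

Lemma of_fps_P i : (i <= 11)%N -> of_fps R (P i) = th (- 1) 0 i 11%N.
Proof.
move=> i11; rewrite jtp ?oner_eq0// invr1 /P /Jam !of_fpsM !of_fps_qpoch; ring.
Qed.

Lemma qsubst_th (p : nat) (c : R) i m : (0 < p)%N -> qsubst p (th c 0 i m) = th c 0 (p%:Z * i) (p%:Z * m).
Proof. by move=> p0; rewrite qsubst_gsum//; apply: eq_gsum => // j; ring. Qed.

(** Centred residues: with s = r - 5, the exponent i j + 3 binz j at j = 11 k + s is i s + 3 binz s
    + 11 ((i + 3 s + 15) k + 33 binz k), and i + 3 s + 15 = i + 3 r lies in [0, 32] for i <= 2. *)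
Definition split11 (x : 'I_11 * int) : int := 11%N%:Z * x.2 + (x.1 : nat)%:Z - 5%N%:Z.

Lemma split11_bij : bijective split11.
Proof.
exists (fun j => (inord `|((j + 5) %% 11)%Z|, ((j + 5) %/ 11)%Z)) => [[r k]|j]; rewrite /split11 /=.
  have lr := ltn_ord r; congr (_, _); last by lia.
  by rewrite -[RHS]inord_val; congr inord; lia.
by rewrite inordK; lia.
Qed.

(** By [jtp] this is J_(x,33) for x <= 33. *)
Definition eta (x : nat) : ser R := th (- 1) 0 x 33%N.

(** Since (- c)^11 = -1, the sum over k has coefficients (-1)^k: c survives only through the residue
    r. *)
Lemma th_dissection (c : R) (i : nat) : (i <= 2)%N -> c ^+ 11 = 1 ->
  th (- c) 0 i 3%N = \sum_(r < 11) serC ((- c) ^ (r%:Z - 5%N%:Z)) *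
     (qX ^+ `|(i%:Z * (r%:Z - 5%N%:Z) + 3 * binz (r%:Z - 5%N%:Z))%R| * qsubst 11 (eta (i + 3 * r))).
Proof.
move=> i2 c11; have c0 : - c != 0.
  by rewrite oppr_eq0; apply/eqP => c0; move/eqP: c11; rewrite c0 expr0n/= eq_sym oner_eq0.
have nc11 : (- c) ^ 11%N = -1 by rewrite -exprnP exprNn c11 mulr1 -signr_odd.
rewrite /th (gsum_split _ split11_bij); last by apply: proper_th.
apply: eq_bigr => r _; rewrite /eta qsubst_th//; have lr := ltn_ord r.
set s := r%:Z - _.
have e0 (t : int) : 0 <= i%:Z * t + 3 * binz t.
  by have := binzE t; move: (binz t) => b; case: i i2 => [|[|[|]]]// _; nia.
rewrite gsumX; last by move=> j; rewrite add0r; apply: th_exp_ge0; lia.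
rewrite gsumZ; last first.
  move=> n; have [S SP] := @proper_th 0 (11%N%:Z * (i + 3 * r)%N%:Z) (11%N%:Z * 33%N%:Z) isT n.
  by exists S => j jn; apply: SP; lia.
apply: eq_gsum => k; rewrite /split11 /= -[11%N%:Z * k + _ - _]addrA -/s.
  by rewrite expfzDr// -exprz_exp nc11 mulrC.
rewrite gez0_abs//; have -> : (i + 3 * r)%N%:Z = i%:Z + 3 * s + 15 by rewrite /s; lia.
apply: (mulfI (x := 2)) => //.
have := binzE (11%N%:Z * k + s); have := binzE s; have := binzE k.
move: (binz _) (binz _) (binz _) => b1 b2 b3 E1 E2 E3.
by lia.
Qed.

Lemma etaC x : (x <= 33)%N -> eta (33 - x)%N = eta x.
Proof. move=> x33; rewrite /eta [RHS]th_refl invrN1.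
by have -> : 33%N%:Z - x%:Z = (33 - x)%N by lia. Qed.

Lemma eta0 : eta 0 = 0.
Proof.
by rewrite /eta jtp ?oner_eq0// [poch 1 0 33]poch_rec// /fac rmorph1 expr0 mulr1 subrr !(mul0r, mulr0).
Qed.

End Dissection.

(** * Quotients of the P_i as theta determinants *)

Section Quotients.
Variable R : fieldType.
Local Notation J1 := (poch (1 : R) 1 1).
Local Notation J11 := (poch (1 : R) 11 11).
Local Notation Pi i := (of_fps R (P i)).

Lemma ser_cancel (u v f g : ser R) : u * v = 1 -> u * f = u * g -> f = g.
Proof. by move=> uv fg; rewrite -[f]mul1r -[g]mul1r -uv mulrC mulrA (mulrC f) fg; ring. Qed.

#[local] Opaque poch.
(** Each nonzero residue mod 11 occurs once among the P_i and (q^11; q^11)_oo occurs five times, one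
    of which completes [J1]. *)
Lemma prod_P : Pi 1 * Pi 2 * Pi 3 * Pi 4 * Pi 5 = J1 * J11 ^+ 4.
Proof.
rewrite (poch_split (1 : R) 1 (p := 11) (m := 1))// muln1.
have -> : \prod_(r < 11) poch (1 : R) (1 + 1 * r) 11 = \prod_(1 <= k < 12) poch 1 k 11.
  by rewrite big_add1 big_mkord; apply: eq_bigr => k _; rewrite mul1n add1n.
do 11![rewrite big_ltn; last by []].
rewrite big_geq; last by [].
rewrite /P /Jam !of_fpsM !of_fps_qpoch.
have [-> -> -> -> ->] : [/\ 11 - 1 = 10, 11 - 2 = 9, 11 - 3 = 8, 11 - 4 = 7 & 11 - 5 = 6]%N by [].
move: (poch 1 1 11) (poch 1 2 11) (poch 1 3 11) (poch 1 4 11) (poch 1 5 11) (poch 1 6 11) (poch 1 7 11)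
  (poch 1 8 11) (poch 1 9 11) (poch 1 10 11) (poch 1 11 11) => p1 p2 p3 p4 p5 p6 p7 p8 p9 p10 p11.
by ring.
Qed.

Lemma J11_unit : J11 ^+ 4 * ipoch 1 11 11 ^+ 4 = 1.
Proof. by rewrite -exprMn poch_ipoch// expr1n. Qed.

(* [thV 1 i 11] divided by [q^i], see [thV_eta]. *)
Definition thetaV (i : nat) : ser R :=
  match i with
  | 1 => qX * eta R 8 - eta R 14
  | 2 => qX ^+ 2 * eta R 5 - eta R 16
  | 3 => qX ^+ 3 * eta R 2 - eta R 13
  | 4 => - qX ^+ 3 * eta R 1 - eta R 10
  | _ => - qX * eta R 4 - eta R 7
  end.

Lemma thU_eta i : thU (1 : R) i 11 = eta R (3 * i).
Proof. by rewrite /thU expr1n. Qed.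

Lemma thV_eta i : (0 < i <= 5)%N -> thV (1 : R) i 11 = qX ^+ i * thetaV i.
Proof.
rewrite /thV !expr1n rmorph1 !mul1r => i5.
have sh : (- 1 : R) ^ (-1) = -1 by rewrite exprN1 invrN1.
have T1 : (3 * i + 11 <= 33)%N -> th (-1) i (3 * i + 11)%N (3 * 11)%N = qX ^+ i * eta R (3 * i + 11).
  by move=> h; rewrite /eta th_qX0//; lia.
have T2 : (3 * i + 2 * 11 <= 33)%N -> th (-1) (2 * i)%N (3 * i + 2 * 11)%N (3 * 11)%N = qX ^+ (2 * i) * eta R (3 * i + 22).
  by move=> h; rewrite /eta th_qX0//; lia.
(* For i = 4, 5 the coefficient 3 i + 22 exceeds 33; the shift by -1 brings it to 3 i - 11 and gives
   the minus sign in the first term of [thetaV]. *)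
have T3 : (11 <= 3 * i)%N -> th (-1) (2 * i)%N (3 * i + 2 * 11)%N (3 * 11)%N = - (qX ^+ (11 - i) * eta R (3 * i - 11)).
  move=> h; rewrite (@th_shift _ (-1)) ?oppr_eq0 ?oner_eq0// sh rmorphN1 mulN1r /eta th_qX0; last by lia.
  have -> : binz (-1) = 1 by [].
  have -> : (2 * i)%N%:Z + (3 * i + 2 * 11)%N%:Z * -1 + (3 * 11)%N%:Z * 1 = (11 - i)%N by lia.
  by have -> : (3 * i + 2 * 11)%N%:Z + (3 * 11)%N%:Z * -1 = (3 * i - 11)%N by lia.
have C x y : (x <= 33)%N -> y = (33 - x)%N -> eta R x = eta R y by move=> ? ->; rewrite etaC.
case: i i5 T1 T2 T3 => [|[|[|[|[|[|i]]]]]] //= _ T1 T2 T3.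
- by rewrite T1// T2// (C 25 8)//; ring.
- by rewrite T1// T2// (C 28 5)// (C 17 16)//; ring.
- by rewrite T1// T2// (C 31 2)// (C 20 13)//; ring.
- by rewrite T1// T3// (C 23 10)//; ring.
- by rewrite T1// T3// (C 26 7)//; ring.
Qed.

(** [winquist] at a = b = 1 over q^11, divided by q^j. By [prod_P] the hypothesis carries J1 J11^4
    on the left, and J11^4 cancels against J11^2 from the hypothesis times J11^2 from [winquist]. *)
Lemma quotient_theta (F : ser R) i j : (0 < j < i)%N -> (i <= 5)%N ->
  Pi 1 * Pi 2 * Pi 3 * Pi 4 * Pi 5 * F = J11 ^+ 2 * (Pi i * Pi j * (Pi (i + j) * Pi (i - j))) ->
  J1 * F = qX ^+ (i - j) * thetaV i * eta R (3 * j) - eta R (3 * i) * thetaV j.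
Proof.
move=> ji i5 HF.
have W := @winquist R 1 1 i j 11 (oner_neq0 _) (oner_neq0 _) isT ltac:(lia) ltac:(lia).
rewrite mulr1 divr1 rmorph1 mul1r -!of_fps_P in W; try by lia.
rewrite !thU_eta !thV_eta in W; try by lia.
apply: (qXn_inj (e := j)); apply: (ser_cancel J11_unit).
transitivity (qX ^+ j * (Pi 1 * Pi 2 * Pi 3 * Pi 4 * Pi 5 * F)); first by rewrite prod_P; ring.
rewrite HF mulrCA W.
have -> : qX ^+ i = qX ^+ j * qX ^+ (i - j) :> ser R by rewrite -exprD subnKC//; lia.
by ring.
Qed.

End Quotients.

Definition sqJ11 := fmul (J 11) (J 11).
(** The series F_r of the dissection. F_6 = 0 expresses that the crank distributes the partitions of
    11 n + 6 equally over the residues mod 11. *)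
Definition crank_quotient (r : nat) : fps :=
  match r with
  | 0 => fmul sqJ11 (Pinv 1)
  | 1 => fmul sqJ11 (fmul (P 5) (fmul (Pinv 2) (Pinv 3)))
  | 2 => fmul sqJ11 (fmul (P 3) (fmul (Pinv 1) (Pinv 4)))
  | 3 => fmul sqJ11 (fmul (P 2) (fmul (Pinv 1) (Pinv 3)))
  | 4 => fmul sqJ11 (Pinv 2)
  | 5 => fmul sqJ11 (fmul (P 4) (fmul (Pinv 2) (Pinv 5)))
  | 6 => fun=> 0
  | 7 => fmul sqJ11 (Pinv 3)
  | 8 => fmul (fqpow 1) (fmul sqJ11 (fmul (P 1) (fmul (Pinv 4) (Pinv 5))))
  | 9 => fmul sqJ11 (Pinv 4)
  | _ => fmul sqJ11 (Pinv 5)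
  end.

Section QuotientTheta.
Variable R : fieldType.
Local Notation Pi i := (of_fps R (P i)).
Local Notation J1 := (poch (1 : R) 1 1).

Lemma Pi_sym i : (i <= 11)%N -> Pi (11 - i) = Pi i.
Proof.
by move=> i11; rewrite /P /Jam !of_fpsM !of_fps_qpoch subKn//; ring.
Qed.

Lemma of_fps_J112 : of_fps R sqJ11 = poch 1 11 11 ^+ 2.
Proof. by rewrite /sqJ11 of_fpsM expr2 of_fps_qpoch. Qed.

Lemma of_fps_quotient1 f : of_fps R (fmul sqJ11 f) = poch 1 11 11 ^+ 2 * of_fps R f.
Proof. by rewrite of_fpsM of_fps_J112. Qed.

Lemma of_fps_quotient3 f g h : of_fps R (fmul sqJ11 (fmul f (fmul g h))) =
  poch 1 11 11 ^+ 2 * (of_fps R f * (of_fps R g * of_fps R h)).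
Proof. by rewrite of_fps_quotient1 (of_fpsM _ f) (of_fpsM _ g). Qed.

Definition theta_quotient i j : ser R :=
  qX ^+ (i - j) * thetaV R i * eta R (3 * j) - eta R (3 * i) * thetaV R j.

Local Notation Pj i := (of_fps R (Pinv i)).

(** Here [l] stands for i + j reduced to 1, ..., 5 by P_(11-s) = P_s, and [m] for i - j. *)
Lemma quotient1_theta k i j l m :
  (0 < j < i)%N -> (i <= 5)%N -> (0 < k < 11)%N ->
  Pi 1 * Pi 2 * Pi 3 * Pi 4 * Pi 5 = Pi k * (Pi i * Pi j * (Pi l * Pi m)) ->
  Pi (i + j) = Pi l -> Pi (i - j) = Pi m ->
  J1 * of_fps R (fmul sqJ11 (Pinv k)) = theta_quotient i j.
Proof.
move=> ji i5 k11 E El Em; apply: (quotient_theta ji i5); rewrite E El Em of_fps_quotient1.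
transitivity (poch 1 11 11 ^+ 2 * (Pi k * Pj k) * (Pi i * Pi j * (Pi l * Pi m))).
  by move: (Pi i) (Pi j) (Pi k) (Pi l) (Pi m) => p1 p2 p3 p4 p5; ring.
by rewrite of_fps_PinvK// mulr1.
Qed.

Lemma quotient3_theta (k k' n i j l m : nat) :
  (0 < j < i)%N -> (i <= 5)%N -> (0 < k < 11)%N -> (0 < k' < 11)%N ->
  Pi n * (Pi 1 * Pi 2 * Pi 3 * Pi 4 * Pi 5) = Pi k * Pi k' * (Pi i * Pi j * (Pi l * Pi m)) ->
  Pi (i + j) = Pi l -> Pi (i - j) = Pi m ->
  J1 * of_fps R (fmul sqJ11 (fmul (P n) (fmul (Pinv k) (Pinv k')))) = theta_quotient i j.
Proof.
move=> ji i5 k11 k11' E El Em; apply: (quotient_theta ji i5); rewrite El Em of_fps_quotient3.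
transitivity (poch 1 11 11 ^+ 2 * (Pj k * Pj k') * (Pi n * (Pi 1 * Pi 2 * Pi 3 * Pi 4 * Pi 5))).
  by move: (Pi 1) (Pi 2) (Pi 3) (Pi 4) (Pi 5) (Pi n) => p1 p2 p3 p4 p5 p; ring.
rewrite E; transitivity (poch 1 11 11 ^+ 2 * (Pi k * Pj k) * (Pi k' * Pj k') * (Pi i * Pi j * (Pi l * Pi m))).
  by move: (Pi i) (Pi j) (Pi k) (Pi k') (Pi l) (Pi m) => p1 p2 p3 p4 p5 p; ring.
by rewrite !of_fps_PinvK// !mulr1.
Qed.

(** The pair (i, j) is dictated by the multiset of i, j, i + j, i - j, taken mod 11 up to sign: it
    must be 1, ..., 5 with k removed for J11^2 / P_k, or with n doubled and k, k' removed for J11^2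
    P_n / (P_k P_k'). *)
Lemma J1_quotient : [/\
  J1 * of_fps R (crank_quotient 0) = theta_quotient 5 2,
  J1 * of_fps R (crank_quotient 4) = theta_quotient 4 1,
  J1 * of_fps R (crank_quotient 7) = theta_quotient 5 4,
  J1 * of_fps R (crank_quotient 9) = theta_quotient 3 2 &
  J1 * of_fps R (crank_quotient 10) = theta_quotient 3 1] /\ [/\
  J1 * of_fps R (crank_quotient 1) = theta_quotient 5 1,
  J1 * of_fps R (crank_quotient 2) = theta_quotient 5 3,
  J1 * of_fps R (crank_quotient 3) = theta_quotient 4 2,
  J1 * of_fps R (crank_quotient 5) = theta_quotient 4 3 &
  J1 * of_fps R (crank_quotient 8) = qX * theta_quotient 2 1].
Proof.
have S6 := @Pi_sym 5 isT; have S7 := @Pi_sym 4 isT; have S8 := @Pi_sym 3 isT; have S9 := @Pi_sym 2 isT.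
have M (x1 x2 x3 x4 x5 : ser R) : let p := x1 * x2 * x3 * x4 * x5 in
  [/\ p = x1 * (x5 * x2 * (x4 * x3)), p = x2 * (x4 * x1 * (x5 * x3)), p = x3 * (x5 * x4 * (x2 * x1)),
      p = x4 * (x3 * x2 * (x5 * x1)) & p = x5 * (x3 * x1 * (x4 * x2))] /\
  [/\ x5 * p = x2 * x3 * (x5 * x1 * (x5 * x4)), x3 * p = x1 * x4 * (x5 * x3 * (x3 * x2)),
      x2 * p = x1 * x3 * (x4 * x2 * (x5 * x2)), x4 * p = x2 * x5 * (x4 * x3 * (x4 * x1)) &
      x1 * p = x4 * x5 * (x2 * x1 * (x3 * x1))].
  by move=> p; rewrite /p; split; split; ring.
have [[M0 M4 M7 M9 M10] [M1 M2 M3 M5 M8]] := M (Pi 1) (Pi 2) (Pi 3) (Pi 4) (Pi 5).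
split; split.
- exact: (@quotient1_theta 1 5 2 4 3).
- exact: (@quotient1_theta 2 4 1 5 3).
- exact: (@quotient1_theta 3 5 4 2 1).
- exact: (@quotient1_theta 4 3 2 5 1).
- exact: (@quotient1_theta 5 3 1 4 2).
- exact: (@quotient3_theta 2 3 5 5 1 5 4).
- exact: (@quotient3_theta 1 4 3 5 3 3 2).
- exact: (@quotient3_theta 1 3 2 4 2 5 2).
- exact: (@quotient3_theta 2 5 4 4 3 4 1).
- rewrite /crank_quotient (of_fpsM _ (fqpow 1)) of_fps_qpow mulrCA expr1; congr (_ * _).
  exact: (@quotient3_theta 4 5 1 2 1 3 1).
Qed.
End QuotientTheta.

(** * The 11-dissection of the crank *)

(* The coefficients of [c_r] on the powers [z^0, ..., z^10]. *)
Definition crank_coef (r : nat) : seq int :=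
  match r with
  | 0 => [:: 1]
  | 1 => [:: -1; 1; 0; 0; 0; 0; 0; 0; 0; 0; 1]
  | 2 => [:: 0; 0; 1; 0; 0; 0; 0; 0; 0; 1; 0]
  | 3 => [:: 1; 0; 0; 1; 0; 0; 0; 0; 1; 0; 0]
  | 4 => [:: 1; 0; 1; 0; 1; 0; 0; 1; 0; 1; 0]
  | 5 => [:: 0; 0; -1; 0; -1; 0; 0; -1; 0; -1; 0]
  | 6 => [:: ]
  | 7 => [:: 0; 1; 0; 0; 1; 0; 0; 1; 0; 0; 1]
  | 8 => [:: 0; 1; 0; 1; 1; 0; 0; 1; 1; 0; 1]
  | 9 => [:: -1; 0; 0; 0; -1; 0; 0; -1; 0; 0; 0]
  | _ => [:: 0; 0; 0; -1; 0; 0; 0; 0; -1; 0; 0]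
  end.

Section CrankDissection.
Variable R : fieldType.
Variable z : R.
Hypothesis z_prim : 11.-primitive_root z.
Local Notation Z := (serC z).
Local Notation E x := (qsubst 11 (eta R x)).

Let z11 : z ^+ 11 = 1. Proof. exact: prim_expr_order. Qed.
Let z0 : z != 0.
Proof. by apply/eqP => z0; move/eqP: z11; rewrite z0 expr0n eq_sym oner_eq0. Qed.
Let Z11 : Z ^+ 11 = 1. Proof. by rewrite -rmorphXn z11 rmorph1. Qed.

Lemma prod_prim_root (x : ser R) : \prod_(k < 11) (1 - serC (z ^+ k) * x) = 1 - x ^+ 11.
Proof.
(* The factors are 1 - z^k x = - z^k (x - z^-k), and z^-1 = z^10 is again primitive. *)
have w_prim : 11.-primitive_root (z ^+ 10) by rewrite prim_root_exp_coprime.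
have F : (map_poly (serC (R := R)) (\prod_(0 <= i < 11) ('X - ((z ^+ 10) ^+ i)%:P))).[x] = x ^+ 11 - 1.
  by rewrite (factor_Xn_sub_1 w_prim) rmorphB rmorph1 /= map_polyXn hornerD hornerN hornerXn hornerC.
rewrite rmorph_prod horner_prod in F.
transitivity (\prod_(k < 11) (- serC (z ^+ k)) * \prod_(k < 11) (x - serC ((z ^+ 10) ^+ k))).
  rewrite -big_split; apply: eq_bigr => k _ /=.
  have : serC (z ^+ k) * serC ((z ^+ 10) ^+ k) = 1.
    by rewrite -rmorphM -!exprM -exprD (_ : k + 10 * k = 11 * k)%N ?exprM ?z11 ?expr1n ?rmorph1//; ring.
  by move=> zz; rewrite -[in LHS]zz; ring.
have -> : \prod_(k < 11) (- serC (z ^+ k)) = -1.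
  rewrite (eq_bigr (fun k : 'I_11 => -1 * Z ^+ k)) => [|k _]; last by rewrite mulN1r rmorphXn.
  rewrite big_split prodrXr prodr_const card_ord /= (_ : (\sum_(i < 11) i)%N = 11 * 5)%N; last first.
    by rewrite !big_ord_recl big_ord0.
  by rewrite exprM Z11 expr1n mulr1 -signr_odd.
rewrite big_mkord in F; rewrite [X in _ * X](_ : _ = x ^+ 11 - 1); first by ring.
by rewrite -F; apply: eq_bigr => k _; rewrite rmorphB /= map_polyX map_polyC hornerD hornerN hornerX hornerC.
Qed.

Lemma prod_poch : \prod_(k < 11) poch (z ^+ k) 1 1 = poch (1 : R) 11 11.
Proof.
rewrite -(iprod_bigprod (I := 'I_11) _ (F := fun k n => fac (z ^+ k) (1 + 1 * n))); last first.
  by move=> k; apply: adm_fac.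
apply: eq_iprod => n; rewrite /fac prod_prim_root -exprM rmorph1 mul1r.
by congr (_ - _ ^+ _); lia.
Qed.

(** The factors 1 - z^k come from (z^k; q)_oo = (1 - z^k) (z^k q; q)_oo in the four theta series of
    [winquist] at i = j = 0; z^2 is its factor b. *)
Definition prefactor : R := z ^+ 2 * ((1 - z ^+ 5) * (1 - z ^+ 2) * (1 - z ^+ 7) * (1 - z ^+ 3)).

Lemma prefactor_neq0 : prefactor != 0.
Proof.
have n k : ~~ (11 %| k)%N -> 1 - z ^+ k != 0.
  by move=> k11; rewrite subr_eq0 eq_sym -(prim_order_dvd z_prim).
by rewrite /prefactor !mulf_neq0 ?expf_neq0 ?n.
Qed.

Lemma th_poch k : th (- z ^+ k) 0 0 1%N =
  poch 1 1 1 * (serC (1 - z ^+ k) * poch (z ^+ k) 1 1 * poch (z ^+ k)^-1 1 1).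
Proof.
rewrite (@jtp R (z ^+ k) 0 1)// ?expf_neq0// (poch_rec _ 0)// /fac expr0 mulr1 rmorphB rmorph1.
by rewrite subn0 add0n; ring.
Qed.

(** By [prod_poch], [crank_series z] times (q^11; q^11)_oo is (q; q)_oo^2 times the product of (z^k
    q; q)_oo over k = 2, ..., 9. The four theta series give this last product with (q; q)_oo^4, and
    the right side of [winquist] accounts for the other two powers. *)
Lemma crank_theta : serC prefactor * (crank_series z * poch 1 11 11) =
  thV (z ^+ 5) 0 1 * thU (z ^+ 2) 0 1 - thU (z ^+ 5) 0 1 * thV (z ^+ 2) 0 1.
Proof.
have W := @winquist R (z ^+ 5) (z ^+ 2) 0 0 1 (expf_neq0 _ z0) (expf_neq0 _ z0) isT isT isT.
rewrite -exprD -expfB// !subn0 addn0 expr0 mulr1 !th_poch in W.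
have U1 : poch (1 : R) 1 1 ^+ 2 * ipoch 1 1 1 ^+ 2 = 1 by rewrite -exprMn poch_ipoch// expr1n.
apply: (ser_cancel U1); rewrite -W.
have V k l : (k + l = 11)%N -> (z ^+ k)^-1 = z ^+ l.
  by move=> kl; apply: (mulfI (expf_neq0 k z0)); rewrite divff ?expf_neq0// -exprD kl z11.
rewrite (V 5 6)// (V 2 9)// (V 7 4)// (V 3 8)// /crank_series -prod_poch.
rewrite -(big_mkord xpredT (fun k => poch (z ^+ k) 1 1)).
do 11![rewrite big_ltn; last by []].
rewrite big_geq; last by [].
have K1 : poch z 1 1 * ipoch z 1 1 = 1 by apply: poch_ipoch.
have K2 : poch (z ^+ 10) 1 1 * ipoch z^-1 1 1 = 1.
  by have := V 1%N 10 erefl; rewrite expr1 => <-; apply: poch_ipoch.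
rewrite expr0 expr1 /prefactor !rmorphM /=.
move: (ipoch z^-1 1 1) (ipoch z 1 1) (poch z 1 1) (poch (z ^+ 10) 1 1) K1 K2 => i1 i2 p1 p10.
move: (poch 1 1 1) (poch (z ^+ 2) 1 1) (poch (z ^+ 3) 1 1) (poch (z ^+ 4) 1 1) (poch (z ^+ 5) 1 1)
 (poch (z ^+ 6) 1 1) (poch (z ^+ 7) 1 1) (poch (z ^+ 8) 1 1) (poch (z ^+ 9) 1 1) => p0 p2 p3 p4 p5 p6 p7 p8 p9.
move: Z (serC (1 - z ^+ 5)) (serC (1 - z ^+ 2)) (serC (1 - z ^+ 7)) (serC (1 - z ^+ 3)) => c a b c' d K1 K2.
transitivity (p0 ^+ 4 * (c * c * (a * b * c' * d)) * (p1 * i2) * (p10 * i1) * (p2 * p3 * p4 * p5 * p6 * p7 * p8 * p9)).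
  by ring.
by rewrite K1 K2; ring.
Qed.


(** The relation (- z^k)^11 = -1 trades the exponent r - 5 for r + 6, so that [ring] meets natural
    powers only. *)
Lemma th_dissectionE k i : (i <= 2)%N -> th (- z ^+ k) 0 i 3%N =
  \sum_(r < 11) - (- Z ^+ k) ^+ (r + 6) *
     (qX ^+ `|(i%:Z * (r%:Z - 5%N%:Z) + 3 * binz (r%:Z - 5%N%:Z))%R| * E (i + 3 * r)).
Proof.
move=> i2; have zk : (z ^+ k) ^+ 11 = 1 by rewrite exprAC z11 expr1n.
rewrite (th_dissection i2 zk); apply: eq_bigr => r _; congr (_ * _).
have -> : (- z ^+ k) ^ (r%:Z - 5%N%:Z) = - (- z ^+ k) ^+ (r + 6).
  have nz : - z ^+ k != 0 by rewrite oppr_eq0 expf_neq0.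
  rewrite -[RHS]mulN1r -[X in X * _](_ : (- z ^+ k) ^- 11 = -1); last first.
    by rewrite exprNn zk mulr1 -signr_odd /= invrN1.
  by rewrite exprnN [_ ^+ (r + 6)]exprnP -expfzDr//; congr (_ ^ _); lia.
by rewrite rmorphN rmorphXn rmorphN rmorphXn.
Qed.

Let EC x y : (x + y = 33)%N -> E x = E y.
Proof. by move=> xy; rewrite -[eta R x]etaC; [congr (qsubst _ (eta _ _)); lia|lia]. Qed.

Let E0 : E 0 = 0.
Proof. by rewrite eta0; apply: serP => n; rewrite coef_qsubst; case: ifP. Qed.

Lemma thUE k : thU (z ^+ k) 0 1 = th (- z ^+ (k * 3)) 0 0 3%N.
Proof. by rewrite /thU exprM. Qed.

Lemma thVE k : thV (z ^+ k) 0 1 =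
  Z ^+ (k * 2) * th (- z ^+ (k * 3)) 0 2 3%N - Z ^+ k * th (- z ^+ (k * 3)) 0 1 3%N.
Proof. by rewrite /thV -!exprM -!rmorphXn. Qed.

(** Rows i = 0, 1, 2 hold the values of i s + 3 s (s - 1) / 2 for s = -5, ..., 5. *)
Let expo i : seq nat :=
  nth [::] [:: [:: 45; 30; 18; 9; 3; 0; 0; 3; 9; 18; 30]; [:: 40; 26; 15; 7; 2; 0; 1; 5; 12; 22; 35];
     [:: 35; 22; 12; 5; 1; 0; 2; 7; 15; 26; 40]]%N i.

Lemma th_dissection_list k i : (i <= 2)%N -> th (- z ^+ k) 0 i 3%N =
  \sum_(0 <= r < 11) - (- Z ^+ k) ^+ (r + 6) * (qX ^+ nth 0%N (expo i) r * E (i + 3 * r)).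
Proof.
move=> i2; rewrite th_dissectionE// -(big_mkord xpredT (fun r => - (- Z ^+ k) ^+ (r + 6) *
     (qX ^+ `|(i%:Z * (r%:Z - 5%N%:Z) + 3 * binz (r%:Z - 5%N%:Z))%R| * E (i + 3 * r)))).
apply: eq_big_nat => r r11; congr (_ * (_ ^+ _ * _)).
by move: i2 r11; do 3?[case: i => [|i]]; do 11?[case: r => [|r]].
Qed.

Let sum11 (V : nmodType) (F : nat -> V) : \sum_(0 <= r < 11) F r =
  F 0%N + F 1%N + F 2 + F 3 + F 4 + F 5 + F 6 + F 7 + F 8 + F 9 + F 10.
Proof. by rewrite unlock /= addr0 !addrA. Qed.

Lemma th0_dissection k : th (- z ^+ k) 0 0%N 3%N =
  - (- Z ^+ k) ^+ 6 * (qX ^+ 45 * E 0)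
  + - (- Z ^+ k) ^+ 7 * (qX ^+ 30 * E 3)
  + - (- Z ^+ k) ^+ 8 * (qX ^+ 18 * E 6)
  + - (- Z ^+ k) ^+ 9 * (qX ^+ 9 * E 9)
  + - (- Z ^+ k) ^+ 10 * (qX ^+ 3 * E 12)
  + - (- Z ^+ k) ^+ 11 * (qX ^+ 0 * E 15)
  + - (- Z ^+ k) ^+ 12 * (qX ^+ 0 * E 18)
  + - (- Z ^+ k) ^+ 13 * (qX ^+ 3 * E 21)
  + - (- Z ^+ k) ^+ 14 * (qX ^+ 9 * E 24)
  + - (- Z ^+ k) ^+ 15 * (qX ^+ 18 * E 27)
  + - (- Z ^+ k) ^+ 16 * (qX ^+ 30 * E 30).
Proof. by rewrite (@th_dissection_list k 0 isT); exact: sum11. Qed.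

Lemma th1_dissection k : th (- z ^+ k) 0 1%N 3%N =
  - (- Z ^+ k) ^+ 6 * (qX ^+ 40 * E 1)
  + - (- Z ^+ k) ^+ 7 * (qX ^+ 26 * E 4)
  + - (- Z ^+ k) ^+ 8 * (qX ^+ 15 * E 7)
  + - (- Z ^+ k) ^+ 9 * (qX ^+ 7 * E 10)
  + - (- Z ^+ k) ^+ 10 * (qX ^+ 2 * E 13)
  + - (- Z ^+ k) ^+ 11 * (qX ^+ 0 * E 16)
  + - (- Z ^+ k) ^+ 12 * (qX ^+ 1 * E 19)
  + - (- Z ^+ k) ^+ 13 * (qX ^+ 5 * E 22)
  + - (- Z ^+ k) ^+ 14 * (qX ^+ 12 * E 25)
  + - (- Z ^+ k) ^+ 15 * (qX ^+ 22 * E 28)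
  + - (- Z ^+ k) ^+ 16 * (qX ^+ 35 * E 31).
Proof. by rewrite (@th_dissection_list k 1 isT); exact: sum11. Qed.

Lemma th2_dissection k : th (- z ^+ k) 0 2%N 3%N =
  - (- Z ^+ k) ^+ 6 * (qX ^+ 35 * E 2)
  + - (- Z ^+ k) ^+ 7 * (qX ^+ 22 * E 5)
  + - (- Z ^+ k) ^+ 8 * (qX ^+ 12 * E 8)
  + - (- Z ^+ k) ^+ 9 * (qX ^+ 5 * E 11)
  + - (- Z ^+ k) ^+ 10 * (qX ^+ 1 * E 14)
  + - (- Z ^+ k) ^+ 11 * (qX ^+ 0 * E 17)
  + - (- Z ^+ k) ^+ 12 * (qX ^+ 2 * E 20)
  + - (- Z ^+ k) ^+ 13 * (qX ^+ 7 * E 23)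
  + - (- Z ^+ k) ^+ 14 * (qX ^+ 15 * E 26)
  + - (- Z ^+ k) ^+ 15 * (qX ^+ 26 * E 29)
  + - (- Z ^+ k) ^+ 16 * (qX ^+ 40 * E 32).
Proof. by rewrite (@th_dissection_list k 2 isT); exact: sum11. Qed.



Definition crank_coef_at r : R := \sum_(0 <= k < 11) (nth 0 (crank_coef r) k)%:~R * z ^+ k.

Lemma serC_crank_coef : [/\ [/\
  serC (crank_coef_at 0) = 1,
  serC (crank_coef_at 1) = - 1 + Z + Z ^+ 10,
  serC (crank_coef_at 2) = Z ^+ 2 + Z ^+ 9,
  serC (crank_coef_at 3) = 1 + Z ^+ 3 + Z ^+ 8 &
  serC (crank_coef_at 4) = 1 + Z ^+ 2 + Z ^+ 4 + Z ^+ 7 + Z ^+ 9] & [/\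
  serC (crank_coef_at 5) = - Z ^+ 2 - Z ^+ 4 - Z ^+ 7 - Z ^+ 9,
  serC (crank_coef_at 7) = Z + Z ^+ 4 + Z ^+ 7 + Z ^+ 10,
  serC (crank_coef_at 8) = Z + Z ^+ 3 + Z ^+ 4 + Z ^+ 7 + Z ^+ 8 + Z ^+ 10,
  serC (crank_coef_at 9) = - 1 - Z ^+ 4 - Z ^+ 7 &
  serC (crank_coef_at 10) = - Z ^+ 3 - Z ^+ 8]].
Proof.
have H r : serC (crank_coef_at r) = \sum_(0 <= k < 11) (nth 0 (crank_coef r) k)%:~R * Z ^+ k.
  by rewrite rmorph_sum; apply: eq_bigr => k _; rewrite rmorphM rmorph_int rmorphXn.
by rewrite !H !sum11 /=; split; split; ring.
Qed.

Lemma serC_prefactor : serC prefactor =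
  Z ^+ 2 * ((1 - Z ^+ 5) * (1 - Z ^+ 2) * (1 - Z ^+ 7) * (1 - Z ^+ 3)).
Proof.
have B k : 1 - Z ^+ k = serC (1 - z ^+ k) by rewrite rmorphB rmorph1 rmorphXn.
by rewrite !B -rmorphXn -!rmorphM.
Qed.

Lemma qsubst_theta_quotient i j : qsubst 11 (theta_quotient R i j) =
  qX ^+ (11 * (i - j)) * qsubst 11 (thetaV R i) * E (3 * j) - E (3 * i) * qsubst 11 (thetaV R j).
Proof. by rewrite /theta_quotient qsubstD qsubstN !qsubstM// qsubst_qX. Qed.

Lemma qsubst_thetaV : [/\
  qsubst 11 (thetaV R 1) = qX ^+ 11 * E 8 - E 14,
  qsubst 11 (thetaV R 2) = qX ^+ 22 * E 5 - E 16,
  qsubst 11 (thetaV R 3) = qX ^+ 33 * E 2 - E 13,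
  qsubst 11 (thetaV R 4) = - qX ^+ 33 * E 1 - E 10 &
  qsubst 11 (thetaV R 5) = - qX ^+ 11 * E 4 - E 7].
Proof.
have H1 k (f g : ser R) : qsubst 11 (qX ^+ k * f - g) = qX ^+ (11 * k) * qsubst 11 f - qsubst 11 g.
  by rewrite qsubstD qsubstN qsubstM// qsubst_qX.
have H2 k (f g : ser R) : qsubst 11 (- qX ^+ k * f - g) = - qX ^+ (11 * k) * qsubst 11 f - qsubst 11 g.
  by rewrite qsubstD qsubstN qsubstM// qsubstN qsubst_qX.
by split; [exact: (H1 1%N)|exact: H1|exact: H1|exact: H2|exact: (H2 1%N)].
Qed.

(** Once reflections reduce the theta series to sixteen, these behave as independent variables: what
    remains is a polynomial identity in them, q and z modulo z^11 = 1. The extra q^11 in class 8 is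
    the factor q of F_8 after substitution. *)
Lemma theta_identity :
  thV (z ^+ 5) 0 1 * thU (z ^+ 2) 0 1 - thU (z ^+ 5) 0 1 * thV (z ^+ 2) 0 1 =
  serC prefactor * (
serC (crank_coef_at 0) * (qX ^+ 0 * qsubst 11 (theta_quotient R 5 2))
  + serC (crank_coef_at 1) * (qX ^+ 1 * qsubst 11 (theta_quotient R 5 1))
  + serC (crank_coef_at 2) * (qX ^+ 2 * qsubst 11 (theta_quotient R 5 3))
  + serC (crank_coef_at 3) * (qX ^+ 3 * qsubst 11 (theta_quotient R 4 2))
  + serC (crank_coef_at 4) * (qX ^+ 4 * qsubst 11 (theta_quotient R 4 1))
  + serC (crank_coef_at 5) * (qX ^+ 5 * qsubst 11 (theta_quotient R 4 3))
  + serC (crank_coef_at 7) * (qX ^+ 7 * qsubst 11 (theta_quotient R 5 4))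
  + serC (crank_coef_at 8) * (qX ^+ 8 * (qX ^+ 11 * qsubst 11 (theta_quotient R 2 1)))
  + serC (crank_coef_at 9) * (qX ^+ 9 * qsubst 11 (theta_quotient R 3 2))
  + serC (crank_coef_at 10) * (qX ^+ 10 * qsubst 11 (theta_quotient R 3 1))).
Proof.
rewrite !thVE !thUE !th0_dissection !th1_dissection !th2_dissection !qsubst_theta_quotient.
have [-> -> -> -> ->] := qsubst_thetaV.
have [[-> -> -> -> ->] [-> -> -> -> ->]] := serC_crank_coef.
rewrite (@EC 32 1 erefl) (@EC 31 2 erefl) (@EC 30 3 erefl) (@EC 29 4 erefl) (@EC 28 5 erefl)
  (@EC 27 6 erefl) (@EC 26 7 erefl) (@EC 25 8 erefl) (@EC 24 9 erefl) (@EC 23 10 erefl)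
  (@EC 22 11 erefl) (@EC 21 12 erefl) (@EC 20 13 erefl) (@EC 19 14 erefl) (@EC 18 15 erefl)
  (@EC 17 16 erefl) E0 serC_prefactor.
move: Z Z11 => z' z'11.
move: (E 1) (E 2) (E 3) (E 4) (E 5) (E 6) (E 7) (E 8) (E 9) (E 10) (E 11) (E 12) (E 13) (E 14) (E 15) (E 16)
  => e1 e2 e3 e4 e5 e6 e7 e8 e9 e10 e11 e12 e13 e14 e15 e16.
ring: z'11.
Qed.
End CrankDissection.

Section CrankComponents.
Variable R : fieldType.
Variable z : R.
Hypothesis z_prim : 11.-primitive_root z.

(** The factor (q^11; q^11)_oo of [crank_theta] is (q; q)_oo taken at q^11, which is exactly the
    factor that [J1_quotient] attaches to each F_r; it cancels together with the prefactor. *)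
Theorem crank_dissection : crank_series z =
  \sum_(0 <= r < 11) serC (crank_coef_at z r) * (qX ^+ r * qsubst 11 (of_fps R (crank_quotient r))).
Proof.
have J : qsubst 11 (poch (1 : R) 1 1) = poch 1 11 11 by rewrite qsubst_poch.
have U : (serC (prefactor z) * poch (1 : R) 11 11) * (serC (prefactor z)^-1 * ipoch 1 11 11) = 1.
  by rewrite mulrACA -rmorphM divff ?prefactor_neq0// rmorph1 mul1r poch_ipoch.
apply: (ser_cancel U); rewrite -mulrA (mulrC (poch _ _ _)) crank_theta// theta_identity// -[RHS]mulrA.
congr (_ * _); rewrite [RHS]mulr_sumr.
pose G r := serC (crank_coef_at z r) * (qX ^+ r * qsubst 11 (poch (1 : R) 1 1 * of_fps R (crank_quotient r))).
transitivity (\sum_(0 <= r < 11) G r); last first.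
  by apply: eq_bigr => r _; rewrite /G qsubstM// J [RHS]mulrCA; congr (_ * _); rewrite mulrCA.
have G6 : G 6 = 0.
  rewrite /G (_ : of_fps R (crank_quotient 6) = 0) ?mulr0; last by apply: serP.
  by rewrite (_ : qsubst 11 0 = 0) ?mulr0//; apply: serP => n; rewrite coef_qsubst; case: ifP.
have S (F : nat -> ser R) : \sum_(0 <= r < 11) F r =
  F 0%N + F 1%N + F 2 + F 3 + F 4 + F 5 + F 6 + F 7 + F 8 + F 9 + F 10 by rewrite unlock /= addr0 !addrA.
rewrite S G6 addr0 /G.
have [[-> -> -> -> ->] [-> -> -> -> ->]] := J1_quotient R.
have Q : qsubst 11 (qX * theta_quotient R 2 1) = qX ^+ 11 * qsubst 11 (theta_quotient R 2 1).
  by rewrite qsubstM//; congr (_ * _); exact: (@qsubst_qX R 11 isT 1).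
by rewrite Q.
Qed.

Lemma crank_series_component n r : (r < 11)%N ->
  crank_series z (11 * n + r)%N = crank_coef_at z r * (crank_quotient r n)%:~R.
Proof.
move=> r11; rewrite crank_dissection coef_ser_sum big_mkord (bigD1 (Ordinal r11))// big1 ?addr0.
  rewrite coef_serCM coef_qXn_qsubst// mulnC modnMDl modn_small// eqxx divnMDl// divn_small// addn0.
  exact: addr0.
move=> i /andP[_ /eqP ir]; rewrite coef_serCM coef_qXn_qsubst// mulnC modnMDl modn_small// ifF ?mulr0//.
by apply/eqP => ri; apply: ir; apply: val_inj.
Qed.

End CrankComponents.

(** * From the crank series to the numbers M(m, n) *)

Lemma crank_bound n (f : ptn n) : is_partition f -> `|crank f| <= n%:Z.
Proof.
move=> pf.
have H : (lambda f <= n)%N by apply/bigop.bigmax_leqP => i _.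
have Hm : (mu f <= n)%N.
  apply: (@leq_trans (\sum_(i < n) i.+1 * f i)); last by rewrite (eqP pf).
  rewrite /mu big_mkcond leq_sum// => i _; case: ifP => // _.
  exact: leq_pmull.
have Ho : (omega f <= n)%N.
  apply: (@leq_trans (\sum_(i < n) i.+1 * f i)); last by rewrite (eqP pf).
  rewrite /omega big_mkcond leq_sum// => i _; case: ifP => // _.
  exact: leq_pmull.
by rewrite /crank; case: ifP => _; lia.
Qed.

(** For n >= 2 partitions are grouped by crank, [crank_bound] keeping every value inside the window;
    for n = 0, 1 the conventional values of M are the coefficients of the product. *)
Lemma Mcrank_gf (R : fieldType) (z : R) n : z != 0 ->
  \sum_(i < (2 * n + 3)%N) (Mcrank (i%:Z - n.+1%:Z) n)%:~R * z ^ (i%:Z - n.+1%:Z) = crank_series z n.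
Proof.
move=> z0; case: n => [|[|n]].
- rewrite crank_series0 !big_ord_recl big_ord0 /= /bump /= mulr0z !mul0r add0r !addr0 mul1r.
  by rewrite -[(1 + 0)%N%:Z - _]/(0 : int) expr0z.
- rewrite crank_series1 !big_ord_recl big_ord0 /= /bump /= mulr0z !mul0r add0r !addr0 !mul1r.
  rewrite -[(1 + 0)%N%:Z - _]/(-1 : int) -[(1 + (1 + 0))%N%:Z - _]/(0 : int).
  rewrite -[(1 + (1 + (1 + 0)))%N%:Z - _]/(1 : int) expr0z exprN1 expr1z rmorphN1; ring.
rewrite -(crank_gf z0)//.
transitivity (\sum_(i < (2 * n.+2 + 3)%N) \sum_(f : ptn n.+2 | is_partition f && (crank f == i%:Z - n.+3%:Z)) z ^ crank f).
  apply: eq_bigr => i _.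
  rewrite (eq_bigr (fun=> z ^ (i%:Z - n.+3%:Z))) => [|f /andP[_ /eqP ->]//].
  by rewrite sumr_const /Mcrank cardsE -pmulrn mulr_natl.
rewrite (exchange_big_dep (fun f => is_partition f)) /=; last by move=> i f _ /andP[].
apply: eq_bigr => f pf.
have B := crank_bound pf.
have ci : (`|(crank f + n.+3%:Z)%R| < 2 * n.+2 + 3)%N by lia.
rewrite (big_pred1 (Ordinal ci))// => i; rewrite pf /=.
by apply/eqP/eqP => [E|->]; [apply: val_inj; rewrite /= E; lia|rewrite /=; lia].
Qed.

(** * Moments modulo 11 *)

(** The additive map sending X^j to j^k, which makes the replacement of z^j by j^k precise. *)
Definition power_sum (k : nat) (p : {poly int}) : 'F_11 := \sum_(i < size p) (p`_i)%:~R * i%:R ^+ k.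

Lemma power_sum_widen k (p : {poly int}) N : (size p <= N)%N ->
  power_sum k p = \sum_(i < N) (p`_i)%:~R * i%:R ^+ k.
Proof.
move=> pN; rewrite /power_sum (big_ord_widen N (fun i : nat => (p`_i)%:~R * i%:R ^+ k) pN) big_mkcond.
apply: eq_bigr => i _; case: ifP => // ip.
by rewrite nth_default ?mul0r// leqNgt ip.
Qed.

Lemma power_sumD k p q : power_sum k (p + q) = power_sum k p + power_sum k q.
Proof.
pose N := maxn (size p) (size q).
rewrite !(@power_sum_widen k _ N) ?leq_maxl ?leq_maxr ?size_polyD// -big_split.
by apply: eq_bigr => i _; rewrite coefD rmorphD mulrDl.
Qed.

Lemma power_sumZ k c p : power_sum k (c *: p) = c%:~R * power_sum k p.
Proof.
rewrite !(@power_sum_widen k _ (size p)) ?size_scale_leq// mulr_sumr.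
by apply: eq_bigr => i _; rewrite coefZ rmorphM mulrA.
Qed.

Lemma power_sum_big k (I : Type) (r : seq I) (F : I -> {poly int}) :
  power_sum k (\sum_(i <- r) F i) = \sum_(i <- r) power_sum k (F i).
Proof.
elim: r => [|i r IH]; last by rewrite !big_cons power_sumD IH.
by rewrite !big_nil /power_sum size_poly0 big_ord0.
Qed.

Lemma power_sumXn k e : power_sum k 'X^e = e%:R ^+ k.
Proof.
rewrite /power_sum size_polyXn big_ord_recr /= coefXn eqxx mul1r big1 ?add0r// => i _.
by rewrite coefXn ltn_eqF ?mul0r.
Qed.

(** The sum runs over all residues, and 10 does not divide k; the proof evaluates every a and k. *)
Lemma residue_power_sum (k : nat) (a : 'F_11) : k \in [:: 2; 4; 6; 8]%N ->
  \sum_(j < 11) (a + j%:R) ^+ k = 0.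
Proof.
move=> k8; rewrite !big_ord_recl big_ord0; apply: val_inj.
move: k8; rewrite !inE => /or4P[] /eqP ->; case: a => m m11;
  by do 11?[case: m m11 => [|m] m11; first by vm_compute].
Qed.

(** Division by the monic 1 + X + ... + X^10 stays over the integers. The remainder vanishes at z
    and has degree below 10, the degree of the minimal polynomial of z over the rationals. *)
Lemma prim_root_dvdp (z : algC) (p : {poly int}) : 11.-primitive_root z ->
  (map_poly intr p).[z] = 0 -> exists q, p = q * \sum_(i < 11) 'X^i.
Proof.
move=> z_prim pz; set Phi := \sum_(i < 11) _.
have PhiE : Phi = \poly_(i < 11) 1 by rewrite poly_def; apply: eq_bigr => i _; rewrite scale1r.
have szPhi : size Phi = 11 by rewrite PhiE size_poly_eq.
have mPhi : Phi \is monic by rewrite monicE lead_coefE szPhi PhiE coef_poly.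
have Phiz : (map_poly intr Phi).[z] = 0.
  have : (z - 1) * (map_poly intr Phi).[z] = 0.
    transitivity (z ^+ 11 - 1 ^+ 11); last by rewrite (prim_expr_order z_prim) expr1n subrr.
    rewrite subrXX rmorph_sum horner_sum.
    congr (_ * _); rewrite [RHS](reindex_inj rev_ord_inj); apply: eq_bigr => i _ /=.
    rewrite expr1n mulr1 map_polyXn hornerXn; congr (_ ^+ _); have := ltn_ord i; lia.
  move/eqP; rewrite mulf_eq0 subr_eq0 -[z]expr1 -(prim_order_dvd z_prim).
  by rewrite expr1 => /eqP.
have E := Pdiv.RingMonic.rdivp_eq mPhi p.
exists (Pdiv.Ring.rdivp p Phi); rewrite {1}E.
set r := Pdiv.Ring.rmodp p Phi in E *.
suff -> : r = 0 by rewrite addr0.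
have szr : (size r < 11)%N.
  by have := Pdiv.Ring.ltn_rmodpN0 p (monic_neq0 mPhi); rewrite szPhi.
have rz : (map_poly intr r).[z] = 0.
  by move: pz; rewrite E rmorphD rmorphM hornerD hornerM Phiz mulr0 add0r.
have [m [Dm _] minm] := minCpolyP z.
have szm : size m = 11.
  by rewrite -(size_map_poly (ratr : rat -> algC)) -Dm (minCpoly_cyclotomic z_prim) size_cyclotomic.
have rr : root (map_poly ratr (map_poly (intr : int -> rat) r)) z.
  rewrite -map_poly_comp (eq_map_poly (g := intr)) => [|x /=]; last by rewrite rmorph_int.
  by rewrite rootE rz.
rewrite minm in rr.
apply: (map_inj_poly (f := intr : int -> rat)) => //; first exact: intr_inj.
rewrite rmorph0; apply/eqP; apply: contraLR szr => r0; rewrite -leqNgt.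
apply: (@leq_trans (size m)); first by rewrite szm.
have <- : size (map_poly (intr : int -> rat) r) = size r.
  by apply: size_map_inj_poly; [exact: intr_inj|].
by apply: dvdp_leq => //; rewrite -minm.
Qed.

Definition moment_const (k r : nat) : 'F_11 := \sum_(j < 11) (nth 0 (crank_coef r) j)%:~R * j%:R ^+ k.

Theorem moment_component (k n r : nat) : k \in [:: 2; 4; 6; 8]%N -> (r < 11)%N ->
  (Mmoment k (11 * n + r)%N)%:~R = moment_const k r * (crank_quotient r n)%:~R.
Proof.
move=> k8 r11; have [z z_prim] := C_prim_root_exists (isT : 0 < 11)%N.
have z0 : z != 0.
  by apply/eqP => z0; have := prim_expr_order z_prim; move/eqP; rewrite z0 expr0n eq_sym oner_eq0.
set N := (11 * n + r)%N.
(* The exponent i + 10 (N + 1) is natural and congruent mod 11 to the crank i - (N + 1), so neither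
   the value at z nor the power sum changes. *)
pose p : {poly int} := \sum_(i < (2 * N + 3)%N) Mcrank (i%:Z - N.+1%:Z) N *: 'X^(i + 10 * N.+1)
   - crank_quotient r n *: \sum_(j < 11) nth 0 (crank_coef r) j *: 'X^j.
have pz : (map_poly intr p).[z] = 0.
  rewrite rmorphB /= map_polyZ /= !rmorph_sum hornerD hornerN hornerZ !horner_sum.
  rewrite [X in X - _](_ : _ = crank_series z N); last first.
    rewrite -Mcrank_gf//; apply: eq_bigr => i _.
    rewrite /= map_polyZ /= map_polyXn hornerZ hornerXn; congr (_ * _).
    rewrite exprnP (_ : (i + 10 * N.+1)%N%:Z = (i%:Z - N.+1%:Z) + 11%N%:Z * N.+1%:Z); last by lia.
    by rewrite [LHS]expfzDr// -exprz_exp -!exprnP (prim_expr_order z_prim) expr1n mulr1.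
  rewrite crank_series_component// mulrC /crank_coef_at big_mkord -mulrBr.
  rewrite [X in _ * (_ - X)](_ : _ = \sum_(j < 11) (nth 0 (crank_coef r) j)%:~R * z ^+ j) ?subrr ?mulr0//.
  by apply: eq_bigr => j _; rewrite /= map_polyZ /= map_polyXn hornerZ hornerXn.
have [q pq] := prim_root_dvdp z_prim pz.
(* Each multiple X^i (1 + X + ... + X^10) has exponents running over a full set of residues. *)
have p0 : power_sum k p = 0.
  rewrite pq -[q]coefK poly_def mulr_suml power_sum_big big1// => i _.
  rewrite -scalerAl mulr_sumr power_sumZ power_sum_big.
  rewrite (eq_bigr (fun j : 'I_11 => (i%:R + j%:R) ^+ k)) ?residue_power_sum ?mulr0// => j _.
  by rewrite -exprD power_sumXn natrD.
move: p0; rewrite /p -scaleN1r power_sumD !power_sumZ !power_sum_big.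
rewrite rmorphN1 mulN1r => /eqP; rewrite subr_eq0 => /eqP p0.
transitivity (\sum_(i < (2 * N + 3)%N) power_sum k (Mcrank (i%:Z - N.+1%:Z) N *: 'X^(i + 10 * N.+1))).
  rewrite rmorph_sum; apply: eq_bigr => i _.
  rewrite power_sumZ power_sumXn [LHS]rmorphM [LHS]mulrC rmorphXn; congr (_ * _ ^+ _).
  rewrite rmorphB natrD natrM /=; congr (_ + _).
  by rewrite -mulN1r; congr (_ * _); apply: val_inj.
rewrite p0 mulrC /moment_const; congr (_ * _); apply: eq_bigr => j _.
by rewrite power_sumZ power_sumXn.
Qed.

Lemma cong11_F11 (f g : fps) : (forall n, (f n)%:~R = (g n)%:~R :> 'F_11) -> cong11 f g.
Proof.
move=> fg n; apply/eqP; rewrite eqz_mod_dvd.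
have := @dvdz_pcharf 'F_11 11 (pchar_Fp (isT : prime 11)) (f n - g n).
by rewrite rmorphB /= fg subrr eqxx.
Qed.

Lemma cong11_TC (c d : int) (k r : nat) (f g : fps) : k \in [:: 2; 4; 6; 8]%N -> (r < 11)%N ->
  (forall n, f n = c * TC k r n) -> (forall n, g n = d * crank_quotient r n) ->
  c%:~R * moment_const k r = d%:~R -> cong11 f g.
Proof.
move=> k8 r11 fE gE cd; apply: cong11_F11 => n.
by rewrite fE gE /TC [LHS]rmorphM [RHS]rmorphM /= moment_component// mulrA cd.
Qed.

(** The last goal is the numerical identity c * [moment_const k r] = d in F_11, settled by
    evaluation. *)
Ltac moment_cong d :=
  match goal with
  | |- cong11 (fscale ?c (TC ?k ?r)) _ => apply: (@cong11_TC c d k r)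
  | |- cong11 (TC ?k ?r) _ => apply: (@cong11_TC 1 d k r)
  end;
  [ by [] | by []
  | by move=> n; rewrite ?mul1r
  | by move=> n; rewrite ?mul0r ?mul1r
  | by rewrite /moment_const !big_ord_recl big_ord0; apply: val_inj; vm_compute ].

Theorem theorem2p9 :
  let J112 := fmul (J 11) (J 11) in
  (* r = 0 *)
  [/\ cong11 (TC 2 0) (fun _ => 0), cong11 (TC 4 0) (fun _ => 0),
      cong11 (TC 6 0) (fun _ => 0) & cong11 (TC 8 0) (fun _ => 0)] /\
  (* r = 1 :  2 J11^2 P5 / (P2 P3) *)
  (let R := fscale 2 (fmul J112 (fmul (P 5) (fmul (Pinv 2) (Pinv 3)))) in
   [/\ cong11 (TC 2 1) R, cong11 (TC 4 1) R, cong11 (TC 6 1) R & cong11 (TC 8 1) R]) /\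
  (* r = 2 :  J11^2 P3 / (P1 P4) *)
  (let R := fmul J112 (fmul (P 3) (fmul (Pinv 1) (Pinv 4))) in
   [/\ cong11 (fscale 7 (TC 2 2)) R, cong11 (fscale 10 (TC 4 2)) R,
       cong11 (fscale 8 (TC 6 2)) R & cong11 (fscale 2 (TC 8 2)) R]) /\
  (* r = 3 :  J11^2 P2 / (P1 P3) *)
  (let R := fmul J112 (fmul (P 2) (fmul (Pinv 1) (Pinv 3))) in
   [/\ cong11 (fscale 8 (TC 2 3)) R, cong11 (fscale 7 (TC 4 3)) R,
       cong11 (fscale 2 (TC 6 3)) R & cong11 (fscale 10 (TC 8 3)) R]) /\
  (* r = 4 :  J11^2 / P2 *)
  (let R := fmul J112 (Pinv 2) in
   [/\ cong11 (fscale 8 (TC 2 4)) R, cong11 (fscale 9 (TC 4 4)) R,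
       cong11 (fscale 3 (TC 6 4)) R & cong11 (fscale 6 (TC 8 4)) R]) /\
  (* r = 5 :  J11^2 P4 / (P2 P5) *)
  (let R := fmul J112 (fmul (P 4) (fmul (Pinv 2) (Pinv 5))) in
   [/\ cong11 (fscale 3 (TC 2 5)) R, cong11 (fscale 2 (TC 4 5)) R,
       cong11 (fscale 8 (TC 6 5)) R & cong11 (fscale 5 (TC 8 5)) R]) /\
  (* r = 7 :  J11^2 / P3 *)
  (let R := fmul J112 (Pinv 3) in
   [/\ cong11 (TC 2 7) R, cong11 (fscale 7 (TC 4 7)) R,
       cong11 (fscale 10 (TC 6 7)) R & cong11 (fscale 5 (TC 8 7)) R]) /\
  (* r = 8 :  q J11^2 P1 / (P4 P5) *)
  (let R := fmul (fqpow 1) (fmul J112 (fmul (P 1) (fmul (Pinv 4) (Pinv 5)))) in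
   [/\ cong11 (fscale 7 (TC 2 8)) R, cong11 (fscale 9 (TC 4 8)) R,
       cong11 (fscale 9 (TC 6 8)) R & cong11 (fscale 7 (TC 8 8)) R]) /\
  (* r = 9 :  J11^2 / P4 *)
  (let R := fmul J112 (Pinv 4) in
   [/\ cong11 (TC 2 9) R, cong11 (fscale 9 (TC 4 9)) R,
       cong11 (fscale 4 (TC 6 9)) R & cong11 (fscale 3 (TC 8 9)) R]) /\
  (* r = 10 :  J11^2 / P5 *)
  (let R := fmul J112 (Pinv 5) in
   [/\ cong11 (fscale 3 (TC 2 10)) R, cong11 (fscale 4 (TC 4 10)) R,
       cong11 (fscale 9 (TC 6 10)) R & cong11 (TC 8 10) R]).
Proof.
move=> J112'.
split; first by split; moment_cong (0 : int).
(* c_1 = z + z^10 - 1 yields 1 + 10^k = 2 for even k. In the remaining classes the multiplier of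
   each moment is the inverse mod 11 of its constant, hence d = 1. *)
split; first by split; moment_cong (2 : int).
by do 8?[split; first by split; moment_cong (1 : int)]; split; moment_cong (1 : int).
Qed.
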